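(* Let $\Omega\subseteq\mathbb{R}^n$ be open and let $u:\Omega\to\mathbb{R}^N$ be an immersion in $C^2(\Omega)^N$. If $u$ is a Minimal $\infty$-Quasiconformal Immersion, then $u$ solves $$K_P(Du)\otimes K_P(Du):D^2u=0\quad\text{on }\Omega,$$ $$[K_P(Du)]^\perp K_{PP}(Du):D^2u=0\quad\text{on }\Omega\setminus\mathcal{S},$$ where $\mathcal{S}$ is the set of interfaces of rank discontinuities of $S(Du^\top Du)$.
   Context: Immersion: a $C^1$ map $u:\Omega\subseteq\mathbb{R}^n\to\mathbb{R}^N$ with $\mathrm{rk}(Du)=n$ everywhere (so $n\le N$). $Du=(D_iu_\alpha)$ is an $N\times n$ matrix. Greek indices run over $1,\dots,N$, Latin ones over $1,\dots,n$; repeated indices are summed. For $P\in\mathbb{R}^{N\times n}$, $|P|=\mathrm{tr}(P^\top P)^{1/2}$. Dilation function: $K(P)=|P|^2\det(P^\top P)^{-1/n}$ if $\det(P^\top P)>0$, and $K(P)=+\infty$ otherwise. $K_P$ and $K_{PP}$ are its first and second derivatives on $\{\det(P^\top P)>0\}$, with components $K_{P_{\alpha i}}$ and $K_{P_{\alpha i}P_{\beta j}}$. For an open set $D$, $K_\infty(u,D)=\|K(Du)\|_{L^\infty(D)}$. $[K_P(Du)]^\perp$ is, at each point, the orthogonal projection of $\mathbb{R}^N$ onto the nullspace of $K_P(Du)^\top:\mathbb{R}^N\to\mathbb{R}^n$. The two systems in index form are $K_{P_{\alpha i}}(Du)K_{P_{\beta j}}(Du)D^2_{ij}u_\beta=0$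 and $[K_P(Du)]^\perp_{\alpha\gamma}K_{P_{\gamma i}P_{\beta j}}(Du)D^2_{ij}u_\beta=0$ for all $\alpha$. Ahlfors operator: $S(A)=\frac12(A+A^\top)-\frac1n\mathrm{tr}(A)I$ for $A\in\mathbb{R}^{n\times n}$. Phases: $\Omega_k=\mathrm{int}\{x\in\Omega:\mathrm{rk}(S(Du^\top Du))=k\}$, $k=0,\dots,n$. Interfaces: $\mathcal{S}=\Omega\setminus\bigcup_{k=0}^n\Omega_k$. Rank-One Locally Minimal Dilation: for every open $D\Subset\Omega$, every $f\in C^1_0(D)$ (a function $f\in C^1(\overline D)$ with $f=0$ on $\partial D$) and every $\xi\in\mathbb{R}^N$ with $|\xi|=1$, $K_\infty(u,D)\le K_\infty(u+f\xi,D)$. $u(\Omega)$ has Minimally Distorted Area: for every open $D\Subset\Omega\setminus\mathcal{S}$, every $h\in C^1(\overline D)$ (not necessarily vanishing on $\partial D$) and every section $\nu$ of $[K_P(Du)]^\perp$ over $D$ (a map $\nu\in C^1(\overline D)^N$ with $\nu^\top K_P(Du)=0$), $K_\infty(u,D)\le K_\infty(u+h\nu,D)$. $u$ is a Minimal $\infty$-Quasiconformal Immersion if it has Rank-One Locally Minimal Dilation and $u(\Omega)$ has Minimally Distorted Area. *)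

(* Defs.v *)
From HB Require Import structures.
From mathcomp Require Import all_boot all_order all_algebra.
From mathcomp Require Import all_classical all_reals all_analysis.

Set Implicit Arguments.
Unset Strict Implicit.
Unset Printing Implicit Defensive.

Import Order.TTheory GRing.Theory Num.Theory.
Import numFieldNormedType.Exports.

Local Open Scope classical_set_scope.
Local Open Scope ring_scope.

(* Points of R^n and values in R^N are row vectors, as for the library Jacobian
   'J.  The norm `|_| on matrices is the max norm; it only
   matters for the topology, and the Euclidean norm is [frobnorm]. *)

Section Calculus.
Context {R : realType} {n : nat}.

Definition partial {V : normedModType R} (i : 'I_n) (f : 'rV[R]_n -> V)
    : 'rV[R]_n -> V :=
  'D_(delta_mx 0 i : 'rV[R]_n) f.

Definition C1 {V : normedModType R} (D : set 'rV[R]_n) (f : 'rV[R]_n -> V) :=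
  forall x, D x ->
    differentiable f x /\ forall i, {for x, continuous (partial i f)}.

Definition C2 {V : normedModType R} (D : set 'rV[R]_n) (f : 'rV[R]_n -> V) :=
  C1 D f /\ forall i, C1 D (partial i f).

(* C^1 on the closure of an open set D: f is C^1 in D, and f and its partial
   derivatives extend continuously to the closure.  The values of f itself on
   the boundary are those of the extension; the partial derivatives computed
   by [partial] at boundary points are not meaningful, hence the witness g. *)
Definition C1_closure {V : normedModType R} (D : set 'rV[R]_n)
    (f : 'rV[R]_n -> V) :=
  [/\ C1 D f, {within closure D, continuous f} &
      forall i, exists g : 'rV[R]_n -> V,
        {within closure D, continuous g} /\
        forall x, D x -> g x = partial i f x].

Definition C1_0 (D : set 'rV[R]_n) (f : 'rV[R]_n -> R) :=
  C1_closure D f /\ forall x, (closure D `\` D) x -> f x = 0.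

Definition compactly_inside (D W : set 'rV[R]_n) :=
  compact (closure D) /\ closure D `<=` W.

(* n-dimensional Lebesgue outer measure, by countable covers with boxes *)
Definition box (a b : 'rV[R]_n) : set 'rV[R]_n :=
  [set x | forall i, a 0 i <= x 0 i <= b 0 i].

Definition box_volume (a b : 'rV[R]_n) : R := \prod_i (b 0 i - a 0 i).

Definition lebesgue_outer (A : set 'rV[R]_n) : \bar R :=
  ereal_inf [set y | exists a b : nat -> 'rV[R]_n,
    [/\ forall k i, a k 0 i <= b k 0 i,
        A `<=` \bigcup_k box (a k) (b k) &
        y = (\sum_(0 <= k <oo) (box_volume (a k) (b k))%:E)%E]].

(* L^oo(D) norm of a nonnegative extended-real function *)
Definition Linfty_norm (D : set 'rV[R]_n) (F : 'rV[R]_n -> \bar R) : \bar R :=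
  ereal_inf [set c | (0 <= c)%E /\
    lebesgue_outer [set x | D x /\ (c < F x)%E] = 0%E].

End Calculus.

Section Dilation.
Context {R : realType} {n N : nat}.

Definition frobnorm {m p} (P : 'M[R]_(m, p)) : R := Num.sqrt (\tr (P^T *m P)).

(* the N x n matrix (D_i u_a) *)
Definition grad (u : 'rV[R]_n -> 'rV[R]_N) (x : 'rV[R]_n) : 'M[R]_(N, n) :=
  ('J u x)^T.

Definition immersion (W : set 'rV[R]_n) (u : 'rV[R]_n -> 'rV[R]_N) :=
  C1 W u /\ forall x, W x -> \rank (grad u x) = n.

Definition dilation (P : 'M[R]_(N, n)) : \bar R :=
  if 0 < \det (P^T *m P)
  then (frobnorm P ^+ 2 * \det (P^T *m P) `^ (- n%:R^-1))%:E
  else +oo%E.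

(* K_P and K_PP; since K is finite on the open set {det (P^T P) > 0},
   [fine] does not affect the derivatives there. *)
Definition dilation_P (P : 'M[R]_(N, n)) : 'M[R]_(N, n) :=
  \matrix_(a, i) 'D_(delta_mx a i : 'M[R]_(N, n)) (fine \o dilation) P.

Definition dilation_PP (a : 'I_N) (i : 'I_n) (b : 'I_N) (j : 'I_n)
    (P : 'M[R]_(N, n)) : R :=
  'D_(delta_mx b j : 'M[R]_(N, n)) (fun Q => dilation_P Q a i) P.

Definition K_infty (u : 'rV[R]_n -> 'rV[R]_N) (D : set 'rV[R]_n) : \bar R :=
  Linfty_norm D (fun x => dilation (grad u x)).

(* Orthogonal projection of R^N (as columns) onto the nullspace of A^T: the
   projection onto ker A^T parallel to its orthogonal complement, the column
   space of A.  mxalgebra subspaces are row spaces, hence the transpositions;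
   see [orth_projP]. *)
Definition orth_proj (A : 'M[R]_(N, n)) : 'M[R]_N :=
  (proj_mx (kermx A) <<A^T>>%MS)^T.

Lemma orth_projP (A : 'M[R]_(N, n)) (v : 'cV[R]_N) :
  A^T *m (orth_proj A *m v) = 0 /\
  forall w : 'cV[R]_N, A^T *m w = 0 -> w^T *m (v - orth_proj A *m v) = 0.
Proof.
have dx : (kermx A :&: <<A^T>> = 0)%MS.
  apply/eqP; rewrite -submx0; apply/row_subP => i.
  set r := row i _.
  have rc : (r <= kermx A :&: <<A^T>>)%MS by exact: row_sub.
  move: rc; rewrite sub_capmx genmxE => /andP[/sub_kermxP r0 /submxP[c rE]].
  have rr : r *m r^T = 0 by rewrite {2}rE trmx_mul trmxK mulmxA r0 mul0mx.
  suff -> : r = 0 by exact: sub0mx.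
  apply/rowP => j; rewrite [RHS]mxE.
  have /eqP : \sum_k r 0 k ^+ 2 = 0.
    transitivity ((r *m r^T) 0 0); last by rewrite rr mxE.
    by rewrite mxE; apply: eq_bigr => k _; rewrite expr2 [r^T _ _]mxE.
  rewrite psumr_eq0; last by move=> k _; exact: sqr_ge0.
  by move=> /allP/(_ j (mem_index_enum j)); rewrite sqrf_eq0 => /eqP.
have full : (kermx A + <<A^T>> :=: 1%:M)%MS.
  apply/eqmxP; rewrite submx1 /= sub1mx /row_full.
  move: (mxrank_sum_cap (kermx A) <<A^T>>%MS); rewrite dx mxrank0 addn0 => ->.
  by rewrite mxrank_ker mxrank_gen mxrank_tr subnK // rank_leq_row.
have tr_proj : orth_proj A *m v = (v^T *m proj_mx (kermx A) <<A^T>>%MS)^T.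
  by rewrite trmx_mul trmxK.
split.
  rewrite tr_proj -trmx_mul.
  by rewrite (sub_kermxP (proj_mx_sub _ _ _)) trmx0.
move=> w w0; have vS : (v^T <= kermx A + <<A^T>>)%MS by rewrite full submx1.
have : (v^T - v^T *m proj_mx (kermx A) <<A^T>>%MS <= A^T)%MS.
  rewrite -[X in (_ <= X)%MS]/(A^T).
  by have := proj_mx_compl_sub vS; rewrite genmxE.
move=> /submxP[c cE].
rewrite tr_proj -[v in v - _]trmxK -linearB /= cE trmx_mul trmxK mulmxA.
by rewrite -[A]trmxK -trmx_mul w0 trmx0 mul0mx.
Qed.

Definition ahlfors (A : 'M[R]_n) : 'M[R]_n :=
  2^-1 *: (A + A^T) - (n%:R^-1 * \tr A) *: 1%:M.

Definition phase (W : set 'rV[R]_n) (u : 'rV[R]_n -> 'rV[R]_N) (k : nat)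
    : set 'rV[R]_n :=
  interior [set x | W x /\ \rank (ahlfors ((grad u x)^T *m grad u x)) = k].

Definition interfaces (W : set 'rV[R]_n) (u : 'rV[R]_n -> 'rV[R]_N)
    : set 'rV[R]_n :=
  W `\` \bigcup_(k in [set k | (k <= n)%N]) phase W u k.

Definition rank_one_locally_minimal_dilation (W : set 'rV[R]_n)
    (u : 'rV[R]_n -> 'rV[R]_N) :=
  forall D : set 'rV[R]_n, open D -> compactly_inside D W ->
  forall f : 'rV[R]_n -> R, C1_0 D f ->
  forall xi : 'rV[R]_N, frobnorm xi = 1 ->
  (K_infty u D <= K_infty (fun x => u x + f x *: xi)%R D)%E.

Definition minimally_distorted_area (W : set 'rV[R]_n)
    (u : 'rV[R]_n -> 'rV[R]_N) :=
  forall D : set 'rV[R]_n, open D -> compactly_inside D (W `\` interfaces W u) ->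
  forall h : 'rV[R]_n -> R, C1_closure D h ->
  forall nu : 'rV[R]_n -> 'rV[R]_N, C1_closure D nu ->
  (forall x, D x -> nu x *m dilation_P (grad u x) = 0) ->
  (K_infty u D <= K_infty (fun x => u x + h x *: nu x)%R D)%E.

Definition minimal_infty_quasiconformal_immersion (W : set 'rV[R]_n)
    (u : 'rV[R]_n -> 'rV[R]_N) :=
  rank_one_locally_minimal_dilation W u /\ minimally_distorted_area W u.

End Dilation.

(* Main.v *)
Require Import Defs.
From HB Require Import structures.
From mathcomp Require Import all_boot all_order all_algebra.
From mathcomp Require Import all_classical all_reals all_analysis.
From mathcomp Require Import ring lra measurable_realfun.

Import Order.TTheory GRing.Theory Num.Theory.
Import numFieldNormedType.Exports.

Local Open Scope classical_set_scope.
Local Open Scope ring_scope.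

(** The dilation [K(Du)] is continuous, so its essential supremum over an open
   set [D] is its maximum over the closure, as soon as nonempty open sets are
   seen to have positive outer measure.  Minimality then forbids any variation
   [w] that lowers [K(Du)] to first order at every maximum point over the
   closure of [D]: by compactness a small multiple of such a [w] would lower the
   maximum itself ([K_infty_descent]).  Both systems come from choosing [D] and
   [w] so that this first-order condition holds unless the system does.

   The chain rule turns [K_P(Du) (x) K_P(Du) : D^2 u] into
   [K_P(Du) D(K(Du))].  If component [a] of it is nonzero at [x], the row [a] of
   [K_P(Du)] is, up to sign, a direction of increase of [K(Du)] near [x].  On a
   small ball around [x] the maxima of [K(Du)] then lie where that row points
   outwards ([max_on_ball_outward]), and there a multiple of the paraboloid
   vanishing on the sphere, in the direction [e_a], lowers [K(Du)]
   ([rank_one_minimal_tangential]).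

   For the second system, [K_P(P) = c P adj(G) S(G)] with [G = P^T P], [c > 0] and
   [S] the Ahlfors operator ([derive_real_dilation]), so [K_P(Du)] has the rank of
   [S(Du^T Du)], which is constant near any point off the interfaces.  A vector
   of the left kernel of [K_P(Du)] at such a point therefore extends to a C^1
   section [nu] of the left kernels ([constant_rank_kernel_section]).  Since
   [nu K_P(Du) = 0] near the point, the first variation [K_P(Du) : D nu] equals
   [- nu . (K_PP(Du) : D^2 u)] ([frobdot_kernel_section]), a quantity that keeps
   its sign on a small ball unless it vanishes; so [K_PP(Du) : D^2 u] is
   orthogonal to the kernel ([minimally_distorted_normal]), and its orthogonal
   projection on the kernel is zero. *)

(** * Continuously differentiable functions and matrices *)

Lemma differentiable_bigsum {R : numFieldType} {V W : normedModType R}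
    (I : Type) (r : seq I) (P : pred I) (f : I -> V -> W) (x : V) :
  (forall i, P i -> differentiable (f i) x) ->
  differentiable (fun y => \sum_(i <- r | P i) f i y) x.
Proof.
move=> df; elim: r => [|i r ih].
  under eq_fun do rewrite big_nil; exact: differentiable_cst.
under eq_fun do rewrite big_cons.
have [Pi|_ //] := boolP (P i).
by apply: (@differentiableD _ _ _ (f i)) ih; exact: df.
Qed.

Lemma derive_bigsum {R : numFieldType} {V W : normedModType R}
    (I : Type) (r : seq I) (P : pred I) (f : I -> V -> W) (x v : V) :
  (forall i, P i -> differentiable (f i) x) ->
  'D_v (fun y => \sum_(i <- r | P i) f i y) x = \sum_(i <- r | P i) 'D_v (f i) x.
Proof.
move=> df; elim: r => [|i r ih].
  by under eq_fun do rewrite big_nil; rewrite derive_cst big_nil.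
under eq_fun do rewrite big_cons.
rewrite big_cons; have [Pi|_ //] := boolP (P i).
rewrite -ih; apply: (@deriveD _ _ _ (f i) (fun y => \sum_(j <- r | P j) f j y)).
  exact/diff_derivable/df.
exact/diff_derivable/differentiable_bigsum.
Qed.

Lemma continuous_bigsum {R : numFieldType} {T : topologicalType}
    {V : normedModType R} (I : Type) (r : seq I) (P : pred I) (f : I -> T -> V) x :
  (forall i, P i -> {for x, continuous (f i)}) ->
  {for x, continuous (fun y => \sum_(i <- r | P i) f i y)}.
Proof. by move=> cf; apply: cvg_big => //; exact: add_continuous. Qed.

Section MatrixValued.
Context {R : realType} {m p : nat}.

Lemma cvg_mx {T : Type} {F : set_system T} {FF : Filter F}
    (G : T -> 'M[R]_(m, p)) (l : 'M[R]_(m, p)) :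
  (forall i j, G t i j @[t --> F] --> l i j) -> G @ F --> l.
Proof.
move=> Gl A [P Pl PA].
have : \forall t \near F, forall i j, P i j (G t i j).
  by apply: filter_forall => i; apply: filter_forall => j; exact: Gl (Pl i j).
by apply: filterS => t /= Pt; exact: PA.
Qed.

Lemma continuous_mx {T : topologicalType} (G : T -> 'M[R]_(m, p)) x :
  (forall i j, {for x, continuous (fun y => G y i j)}) -> {for x, continuous G}.
Proof. by move=> cG; apply: (@cvg_mx _ (nbhs x) (nbhs_filter x)) => i j; exact: cG. Qed.

Lemma differentiable_mx {V : normedModType R} (G : V -> 'M[R]_(m, p)) x :
  (forall i j, differentiable (fun y => G y i j) x) -> differentiable G x.
Proof.
move=> dG.
have -> : G = (fun y => \sum_i \sum_j G y i j *: delta_mx i j).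
  by apply/funext => y; exact: matrix_sum_delta.
apply: differentiable_bigsum => i _; apply: differentiable_bigsum => j _.
exact: differentiableZl.
Qed.

Lemma differentiable_mx_coord {V : normedModType R} (G : V -> 'M[R]_(m, p)) x i j :
  differentiable G x -> differentiable (fun y => G y i j) x.
Proof.
by move=> dG; apply: (differentiable_comp dG (differentiable_coord (G x) i j)).
Qed.

Lemma derive_mx_coord {V : normedModType R} (G : V -> 'M[R]_(m, p)) x v i j :
  differentiable G x -> 'D_v (fun y => G y i j) x = ('D_v G x) i j.
Proof. by move=> dG; rewrite derive_mx ?mxE//; exact: diff_derivable. Qed.

Lemma derive_comp_mx {V : normedModType R} (F : 'M[R]_(m, p) -> R)
    (G : V -> 'M[R]_(m, p)) (x v : V) :
  differentiable G x -> differentiable F (G x) ->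
  'D_v (fun y => F (G y)) x =
  \sum_i \sum_j 'D_(delta_mx i j) F (G x) * 'D_v (fun y => G y i j) x.
Proof.
move=> dG dF.
rewrite deriveE; last exact: differentiable_comp.
rewrite (diff_comp dG dF) /= -(deriveE v dG) (matrix_sum_delta (derive G x v)).
rewrite linear_sum; apply: eq_bigr => i _; rewrite linear_sum.
apply: eq_bigr => j _; rewrite linearZ /= -(deriveE _ dF) -(derive_mx_coord _ _ _ i j dG).
by rewrite mulrC.
Qed.

End MatrixValued.

Section ContinuouslyDifferentiable.
Context {R : realType} {V : normedModType R}.
Implicit Types (f g : V -> R) (x v : V).

(** Asking for the directional derivatives to be continuous at the single point
   [x] makes the notion stable under the algebraic operations without carrying
   an open domain along. *)
Definition C1_at f x :=
  (\forall y \near x, differentiable f y) /\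
  forall v, {for x, continuous ('D_v f)}.

Lemma C1_at_differentiable {f x} : C1_at f x -> differentiable f x.
Proof. by case=> /nbhs_singleton. Qed.

Lemma C1_at_continuous {f x} : C1_at f x -> {for x, continuous f}.
Proof. by move=> /C1_at_differentiable/differentiable_continuous. Qed.

Lemma C1_at_cst (c : R) x : C1_at (fun=> c) x.
Proof.
split; first by near=> y; exact: differentiable_cst.
move=> v; have -> : 'D_v (fun=> c) = (fun=> 0 : R).
  by apply/funext => y; exact: derive_cst.
exact: cst_continuous.
Unshelve. all: by end_near. Qed.

Lemma C1_atD f g x : C1_at f x -> C1_at g x -> C1_at (fun y => f y + g y) x.
Proof.
move=> [df cf] [dg cg]; split.
  by near=> y; apply: (@differentiableD _ _ _ f g); [near: y|near: y].
move=> v.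
have e : {near x, (fun y => 'D_v f y + 'D_v g y) =1 'D_v (fun y => f y + g y)}.
  near=> y; apply/esym; apply: (@deriveD _ _ _ f g); apply: diff_derivable.
    by near: y.
  by near: y.
rewrite /prop_for /continuous_at -(nbhs_singleton e).
apply: cvg_trans (near_eq_cvg e) _.
exact: cvgD (cf v) (cg v).
Unshelve. all: by end_near. Qed.

Lemma C1_atM f g x : C1_at f x -> C1_at g x -> C1_at (fun y => f y * g y) x.
Proof.
move=> Cf Cg; have [df cf] := Cf; have [dg cg] := Cg; split.
  by near=> y; apply: (@differentiableM _ _ f g); [near: y|near: y].
move=> v.
have e : {near x, (fun y => f y * 'D_v g y + g y * 'D_v f y)
                   =1 'D_v (fun y => f y * g y)}.
  near=> y; apply/esym; apply: (@deriveM _ _ f g); apply: diff_derivable.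
    by near: y.
  by near: y.
rewrite /prop_for /continuous_at -(nbhs_singleton e).
apply: cvg_trans (near_eq_cvg e) _.
apply: cvgD; apply: cvgM.
- exact: C1_at_continuous.
- exact: cg.
- exact: C1_at_continuous.
- exact: cf.
Unshelve. all: by end_near. Qed.

Lemma C1_at_sum (I : Type) (r : seq I) (P : pred I) (f : I -> V -> R) x :
  (forall i, P i -> C1_at (f i) x) -> C1_at (fun y => \sum_(i <- r | P i) f i y) x.
Proof.
move=> Cf; elim: r => [|i r ih].
  by under eq_fun do rewrite big_nil; exact: C1_at_cst.
under eq_fun do rewrite big_cons.
by have [Pi|_ //] := boolP (P i); apply: C1_atD ih; exact: Cf.
Qed.

Lemma C1_at_prod (I : Type) (r : seq I) (P : pred I) (f : I -> V -> R) x :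
  (forall i, P i -> C1_at (f i) x) -> C1_at (fun y => \prod_(i <- r | P i) f i y) x.
Proof.
move=> Cf; elim: r => [|i r ih].
  by under eq_fun do rewrite big_nil; exact: C1_at_cst.
under eq_fun do rewrite big_cons.
by have [Pi|_ //] := boolP (P i); apply: C1_atM ih; exact: Cf.
Qed.

Lemma derive_comp_real f (g dg : R -> R) x v : differentiable f x ->
  is_derive (f x) 1 g (dg (f x)) ->
  differentiable (fun y => g (f y)) x /\
  'D_v (fun y => g (f y)) x = dg (f x) * 'D_v f x.
Proof.
move=> df [dg' dgE].
have dg1 : differentiable g (f x) by exact/derivable1_diffP.
have dgf : differentiable (g \o f) x by exact: differentiable_comp.
split; first exact: dgf.
rewrite (deriveE v dgf) (diff_comp df dg1) /= -(deriveE v df) diff1E //.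
by rewrite derive1E dgE mulrC.
Qed.

Lemma C1_at_comp f (g dg : R -> R) x : C1_at f x ->
  (\forall t \near f x, is_derive (t : R) (1 : R) g (dg t)) -> {for f x, continuous dg} ->
  C1_at (fun y => g (f y)) x.
Proof.
move=> Cf g' cdg; have [df cf] := Cf.
have g'f : \forall y \near x, is_derive (f y) (1 : R) g (dg (f y)).
  exact: (C1_at_continuous Cf _ g').
split.
  by near=> y; apply: (proj1 (derive_comp_real f g dg y 0 _ _)); near: y.
move=> v.
have e : {near x, (fun y => dg (f y) * 'D_v f y) =1 'D_v (fun y => g (f y))}.
  by near=> y; apply/esym; apply: (proj2 (derive_comp_real f g dg y v _ _)); near: y.
rewrite /prop_for /continuous_at -(nbhs_singleton e).
apply: cvg_trans (near_eq_cvg e) _.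
apply: cvgM; last exact: cf.
apply: (continuous_comp (C1_at_continuous Cf)); exact: cdg.
Unshelve. all: by end_near. Qed.

Lemma C1_atN f x : C1_at f x -> C1_at (fun y => - f y) x.
Proof.
move=> Cf; under eq_fun do rewrite -mulN1r.
by apply: C1_atM Cf; exact: C1_at_cst.
Qed.

Lemma C1_at_powR f (a : R) x : 0 < f x -> C1_at f x ->
  C1_at (fun y => f y `^ a) x.
Proof.
move=> f0 Cf.
have H := C1_at_comp f (@powR R ^~ a) (fun t => a * t `^ (a - 1)) x Cf.
apply: H.
  near=> t; apply: is_derive1_powR; near: t.
  exact: lt_nbhsr.
apply: cvgM; first exact: cvg_cst.
apply: (@differentiable_continuous _ _ _ _ (@powR R ^~ (a - 1))).
by apply/derivable1_diffP; have [] := is_derive1_powR (a - 1) f0.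
Unshelve. all: by end_near. Qed.

Definition C1_mx_at {m p} (G : V -> 'M[R]_(m, p)) x :=
  forall i j, C1_at (fun y => G y i j) x.

Lemma C1_mx_at_cst {m p} (A : 'M[R]_(m, p)) x : C1_mx_at (fun=> A) x.
Proof. by move=> i j; exact: C1_at_cst. Qed.

Lemma C1_mx_at_tr {m p} (G : V -> 'M[R]_(m, p)) x :
  C1_mx_at G x -> C1_mx_at (fun y => (G y)^T) x.
Proof. by move=> CG i j; under eq_fun do rewrite mxE; exact: CG. Qed.

Lemma C1_mx_atD {m p} (G H : V -> 'M[R]_(m, p)) x :
  C1_mx_at G x -> C1_mx_at H x -> C1_mx_at (fun y => G y + H y) x.
Proof.
by move=> CG CH i j; under eq_fun do rewrite mxE; exact: C1_atD.
Qed.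

Lemma C1_mx_atN {m p} (G : V -> 'M[R]_(m, p)) x :
  C1_mx_at G x -> C1_mx_at (fun y => - G y) x.
Proof. by move=> CG i j; under eq_fun do rewrite mxE; exact: C1_atN. Qed.

Lemma C1_mx_atZ {m p} f (G : V -> 'M[R]_(m, p)) x :
  C1_at f x -> C1_mx_at G x -> C1_mx_at (fun y => f y *: G y) x.
Proof.
by move=> Cf CG i j; under eq_fun do rewrite mxE; exact: C1_atM.
Qed.

Lemma C1_mx_atM {m p q} (G : V -> 'M[R]_(m, p)) (H : V -> 'M[R]_(p, q)) x :
  C1_mx_at G x -> C1_mx_at H x -> C1_mx_at (fun y => G y *m H y) x.
Proof.
move=> CG CH i j; under eq_fun do rewrite mxE.
by apply: C1_at_sum => k _; exact: C1_atM.
Qed.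

Lemma C1_at_tr {m} (G : V -> 'M[R]_m) x :
  C1_mx_at G x -> C1_at (fun y => \tr (G y)) x.
Proof. by move=> CG; apply: C1_at_sum => i _. Qed.

Lemma C1_at_det {m} (G : V -> 'M[R]_m) x :
  C1_mx_at G x -> C1_at (fun y => \det (G y)) x.
Proof.
move=> CG; apply: C1_at_sum => s _; apply: C1_atM; first exact: C1_at_cst.
by apply: C1_at_prod => i _.
Qed.

Lemma C1_mx_at_adj {m} (G : V -> 'M[R]_m) x :
  C1_mx_at G x -> C1_mx_at (fun y => \adj (G y)) x.
Proof.
move=> CG i j; under eq_fun do rewrite mxE.
apply: C1_atM; first exact: C1_at_cst.
by apply: C1_at_det => k l; under eq_fun do rewrite !mxE; exact: CG.
Qed.

Lemma C1_mx_at_continuous {m p} (G : V -> 'M[R]_(m, p)) x :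
  C1_mx_at G x -> {for x, continuous G}.
Proof. by move=> CG; apply: continuous_mx => i j; exact: C1_at_continuous. Qed.

End ContinuouslyDifferentiable.

Lemma C1_mx_at_id {R : realType} {m p} (P : 'M[R]_(m, p)) : C1_mx_at id P.
Proof.
move=> i j; split; first by near=> Q; exact: differentiable_coord.
move=> v; have -> : 'D_v (fun Q : 'M[R]_(m, p) => Q i j) = (fun=> v i j).
  apply/funext => Q; rewrite (@derive_mx_coord _ _ _ _ id) ?derive_id//.
exact: cst_continuous.
Unshelve. all: by end_near. Qed.

Lemma C1_at_id {R : realType} (t : R) : C1_at (fun s : R => s) t.
Proof.
split; first by near=> s.
move=> v; have -> : 'D_v (fun s : R => s) = (fun=> v).
  by apply/funext => s; rewrite derive_id.
exact: cst_continuous.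
Unshelve. all: by end_near. Qed.

(** * Gram determinants and the derivative of the dilation *)

Lemma mulmx_trE {R : comNzRingType} {k} (v : 'rV[R]_k) :
  (v *m v^T) 0 0 = \sum_j v 0 j ^+ 2.
Proof. by rewrite mxE; apply: eq_bigr => j _; rewrite mxE expr2. Qed.

Lemma mulmx_tr_ge0 {R : realFieldType} {k} (v : 'rV[R]_k) : 0 <= (v *m v^T) 0 0.
Proof. by rewrite mulmx_trE; apply: sumr_ge0 => j _; exact: sqr_ge0. Qed.

Lemma mulmx_tr_eq0 {R : realFieldType} {k} (v : 'rV[R]_k) :
  ((v *m v^T) 0 0 == 0) = (v == 0).
Proof.
apply/idP/eqP => [|->]; last by rewrite mul0mx mxE.
rewrite mulmx_trE psumr_eq0; last by move=> j _; exact: sqr_ge0.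
move=> /allP v0; apply/rowP => j; rewrite mxE.
by have := v0 j (mem_index_enum j); rewrite sqrf_eq0 => /eqP.
Qed.

(** The cofactors along row [i] do not involve the entries of that row, so the
   determinant is affine in each entry. *)
Lemma det_add_delta {R : comNzRingType} {k} (A : 'M[R]_k) i j h :
  \det (h *: delta_mx i j + A) = \det A + h * cofactor A i j.
Proof.
have cE l : cofactor (h *: delta_mx i j + A) i l = cofactor A i l.
  congr (_ * \det _); apply/matrixP => a b; rewrite !mxE.
  by rewrite eq_sym (negPf (neq_lift _ _)) /= mulr0 add0r.
rewrite !(expand_det_row _ i).
under eq_bigr => l _ do rewrite cE !mxE eqxx /= mulrDl.
rewrite big_split /= addrC; congr (_ + _).
rewrite (bigD1 j) //= eqxx mulr1 big1 ?addr0 // => l /negPf lj.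
by rewrite lj mulr0 mul0r.
Qed.

Lemma derive_det {R : realType} {k} (A : 'M[R]_k) i j :
  'D_(delta_mx i j) (fun B : 'M[R]_k => \det B) A = cofactor A i j.
Proof.
apply: cvg_lim; first exact: norm_hausdorff.
apply: (@cvg_trans _ ((fun=> cofactor A i j) @ (0 : R)^')); last exact: cvg_cst.
apply: near_eq_cvg; near=> h.
rewrite /= det_add_delta addrAC subrr add0r scalerA mulVf ?scale1r //.
near: h; exact: nbhs_dnbhs_neq.
Unshelve. all: by end_near. Qed.

Section Gram.
Context {R : realType} {n N : nat}.
Implicit Types P : 'M[R]_(N, n).

Definition gram P : 'M[R]_n := P^T *m P.

Lemma gramE P j l : gram P j l = \sum_b P b j * P b l.
Proof. by rewrite mxE; apply: eq_bigr => b _; rewrite mxE. Qed.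

Lemma gram_sym P : (gram P)^T = gram P.
Proof. by rewrite /gram trmx_mul trmxK. Qed.

Lemma gram_tr_ge0 P : 0 <= \tr (gram P).
Proof.
apply: sumr_ge0 => i _; rewrite gramE; apply: sumr_ge0 => b _.
by rewrite -expr2 sqr_ge0.
Qed.

Lemma frobnorm_sqr P : frobnorm P ^+ 2 = \tr (gram P).
Proof. by rewrite sqr_sqrtr // gram_tr_ge0. Qed.

(** All matrices of the segment from the identity to [gram P] are positive
   definite; the determinant does not vanish along it and keeps the sign it has
   at the identity. *)
Lemma gram_det_gt0 P : \rank P = n -> 0 < \det (gram P).
Proof.
move=> rP.
pose H (t : R) : 'M[R]_n := (1 - t) *: 1%:M + t *: gram P.
have Hneq0 t : 0 <= t <= 1 -> \det (H t) != 0.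
  move=> /andP[t0 t1]; apply/det0P => -[v v0 vH].
  have : (v *m H t *m v^T) 0 0 = 0 by rewrite vH mul0mx mxE.
  have -> : (v *m H t *m v^T) 0 0 =
      (1 - t) * (v *m v^T) 0 0 + t * ((v *m P^T) *m (v *m P^T)^T) 0 0.
    rewrite /H /gram mulmxDr -!scalemxAr mulmx1 mulmxDl -!scalemxAl.
    by rewrite trmx_mul trmxK !mulmxA [LHS]mxE; congr (_ + _); rewrite [LHS]mxE.
  move/eqP; rewrite paddr_eq0; last 2 first.
  - by rewrite mulr_ge0 ?mulmx_tr_ge0 // subr_ge0.
  - by rewrite mulr_ge0 ?mulmx_tr_ge0.
  rewrite !mulf_eq0 !mulmx_tr_eq0 (negPf v0) orbF subr_eq0 => /andP[/eqP <-].
  rewrite oner_eq0 /= => /eqP vP; move/eqP: v0; apply.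
  have fP : row_free P^T by rewrite /row_free mxrank_tr rP.
  by apply: (row_free_inj fP); rewrite mul0mx.
have cH : continuous (fun t => \det (H t)).
  move=> t; apply: C1_at_continuous; apply: C1_at_det.
  apply: C1_mx_atD; apply: C1_mx_atZ; try exact: C1_mx_at_cst; last exact: C1_at_id.
  by apply: C1_atD; [exact: C1_at_cst|apply: C1_atN; exact: C1_at_id].
have H0 : \det (H 0) = 1 by rewrite /H subr0 scale1r scale0r addr0 det1.
have H1 : \det (H 1) = \det (gram P) by rewrite /H subrr scale0r scale1r add0r.
rewrite ltNge; apply/negP => le0.
have [] := @IVT R (fun t => \det (H t)) 0 1 0 ler01.
- exact: continuous_subspaceT.
- by rewrite H0 H1 ge_min le_max le0 ler01 orbT.
move=> t; rewrite in_itv /= => t01 /eqP.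
by apply/negP; exact: Hneq0.
Qed.

(** The real value of the dilation where it is finite; for [\det (gram P) = 0] it
   is a junk value. *)
Definition real_dilation P : R := \tr (gram P) * \det (gram P) `^ (- n%:R^-1).

(** Closed form of [K_P], factored through the Ahlfors operator so that its rank
   can be read off. *)
Definition dilation_grad P : 'M[R]_(N, n) :=
  (2 * \det (gram P) `^ (- n%:R^-1 - 1)) *:
  (P *m \adj (gram P) *m ahlfors (gram P)).

Lemma dilationE P : 0 < \det (gram P) -> dilation P = (real_dilation P)%:E.
Proof. by rewrite /dilation -/(gram P) => ->; rewrite frobnorm_sqr. Qed.

Lemma real_dilation_ge0 P : 0 <= real_dilation P.
Proof. by rewrite mulr_ge0 ?gram_tr_ge0 // powR_ge0. Qed.

Section Regularity.
Context {V : normedModType R} (G : V -> 'M[R]_(N, n)) (x : V)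
  (CG : C1_mx_at G x).

Lemma C1_mx_at_gram : C1_mx_at (fun y => gram (G y)) x.
Proof. by apply: C1_mx_atM => //; exact: C1_mx_at_tr. Qed.

Lemma C1_at_gram_det : C1_at (fun y => \det (gram (G y))) x.
Proof. exact/C1_at_det/C1_mx_at_gram. Qed.

Lemma near_gram_det_gt0 : 0 < \det (gram (G x)) ->
  \forall y \near x, 0 < \det (gram (G y)).
Proof.
exact: cvgr_gt (C1_at_continuous C1_at_gram_det) _.
Qed.

Context (d0 : 0 < \det (gram (G x))).

Lemma C1_at_real_dilation : C1_at (fun y => real_dilation (G y)) x.
Proof.
apply: C1_atM; first exact/C1_at_tr/C1_mx_at_gram.
by apply: C1_at_powR => //; exact: C1_at_gram_det.
Qed.

Lemma C1_mx_at_dilation_grad : C1_mx_at (fun y => dilation_grad (G y)) x.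
Proof.
have CD := C1_at_gram_det.
apply: C1_mx_atZ.
  by apply: C1_atM; [exact: C1_at_cst|exact: C1_at_powR].
apply: C1_mx_atM.
  by apply: C1_mx_atM => //; apply: C1_mx_at_adj; exact: C1_mx_at_gram.
apply: C1_mx_atD.
  apply: C1_mx_atZ; first exact: C1_at_cst.
  apply: C1_mx_atD; [|apply: C1_mx_at_tr]; exact: C1_mx_at_gram.
apply: C1_mx_atN; apply: C1_mx_atZ; last exact: C1_mx_at_cst.
apply: C1_atM; first exact: C1_at_cst.
exact/C1_at_tr/C1_mx_at_gram.
Qed.

End Regularity.


Lemma derive_gram P a i j l :
  'D_(delta_mx a i) (fun Q : 'M[R]_(N, n) => gram Q j l) P =
  (j == i)%:R * P a l + (l == i)%:R * P a j.
Proof.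
under [in LHS]eq_fun do rewrite gramE.
have dc b k : differentiable (fun Q : 'M[R]_(N, n) => Q b k) P.
  exact: differentiable_coord.
have dcE b k : 'D_(delta_mx a i) (fun Q : 'M[R]_(N, n) => Q b k) P =
    (b == a)%:R * (k == i)%:R.
  by rewrite (derive_mx_coord id) ?derive_id ?mxE ?mulnb ?natrM -?mulnb ?natrM.
rewrite derive_bigsum; last by move=> b _; exact: (differentiableM (dc b j)).
transitivity (\sum_b (b == a)%:R * (P b j * (l == i)%:R + P b l * (j == i)%:R)).
  apply: eq_bigr => b _.
  rewrite (@deriveM _ _ (fun Q : 'M[R]_(N, n) => Q b j) (fun Q => Q b l)).
  - by rewrite !dcE /GRing.scale /= mulrDr; congr (_ + _); rewrite mulrCA.
  - exact: diff_derivable.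
  - exact: diff_derivable.
rewrite (bigD1 a) //= eqxx big1 ?addr0; first by rewrite mul1r; ring.
by move=> b /negPf ->; rewrite mul0r.
Qed.

Lemma derive_gram_tr P a i :
  'D_(delta_mx a i) (fun Q : 'M[R]_(N, n) => \tr (gram Q)) P = 2 * P a i.
Proof.
rewrite derive_bigsum; last first.
  by move=> j _; exact: C1_at_differentiable (C1_mx_at_gram _ _ (C1_mx_at_id P) j j).
under eq_bigr do rewrite derive_gram.
rewrite (bigD1 i) //= eqxx big1 ?addr0; first by rewrite mul1r; ring.
by move=> j /negPf ->; rewrite !mul0r addr0.
Qed.

(** Jacobi's formula for the Gram determinant; the factor 2 appears because [gram]
   is quadratic and its adjugate symmetric. *)
Lemma derive_gram_det P a i :
  'D_(delta_mx a i) (fun Q : 'M[R]_(N, n) => \det (gram Q)) P =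
  2 * (P *m \adj (gram P)) a i.
Proof.
have CG := C1_mx_at_gram _ _ (C1_mx_at_id P).
rewrite (derive_comp_mx (fun B : 'M[R]_n => \det B) gram); first last.
- exact: C1_at_differentiable (C1_at_det _ _ (C1_mx_at_id (gram P))).
- by apply: differentiable_mx => j l; exact: C1_at_differentiable (CG j l).
under eq_bigr do under eq_bigr do rewrite derive_det derive_gram.
have adjE j l : cofactor (gram P) j l = \adj (gram P) j l.
  by rewrite mxE -cofactor_tr gram_sym.
transitivity (\sum_j \sum_l (j == i)%:R * (P a l * \adj (gram P) j l) +
              \sum_l \sum_j (l == i)%:R * (P a j * \adj (gram P) j l)).
  rewrite [X in _ = _ + X]exchange_big -big_split; apply: eq_bigr => j _ /=.
  by rewrite -big_split; apply: eq_bigr => l _ /=; rewrite adjE; ring.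
rewrite [X in X + _](bigD1 i) //= [X in _ + X + _]big1 ?addr0; last first.
  by move=> j /negPf ji; rewrite big1 // => l _; rewrite ji mul0r.
rewrite [X in _ + X](bigD1 i) //= [X in _ + (_ + X)]big1 ?addr0; last first.
  by move=> j /negPf ji; rewrite big1 // => l _; rewrite ji mul0r.
rewrite mulr_natl mulr2n mxE; congr (_ + _); apply: eq_bigr => l _.
  by rewrite eqxx mul1r -[in RHS](gram_sym P) -trmx_adj [in RHS]mxE.
by rewrite eqxx mul1r.
Qed.

(** The two terms of the product rule combine into the Ahlfors operator by
   [\adj G *m G = \det G]. *)
Lemma derive_real_dilation P a i : 0 < \det (gram P) ->
  'D_(delta_mx a i) real_dilation P = dilation_grad P a i.
Proof.
move=> d0; have Cid := C1_mx_at_id P.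
pose s : R := - n%:R^-1.
have Cd := C1_at_gram_det _ _ Cid.
have [dpow powE] := derive_comp_real _ (@powR R ^~ s) (fun t => s * t `^ (s - 1))
  P (delta_mx a i) (C1_at_differentiable Cd) (is_derive1_powR s d0).
have dtr : differentiable (fun Q : 'M[R]_(N, n) => \tr (gram Q)) P.
  exact: C1_at_differentiable (C1_at_tr _ _ (C1_mx_at_gram _ _ Cid)).
pose tr_gram (Q : 'M[R]_(N, n)) := \tr (gram Q).
pose det_pow (Q : 'M[R]_(N, n)) := \det (gram Q) `^ s.
rewrite -[LHS]/('D_(delta_mx a i) (tr_gram * det_pow) P).
rewrite deriveM; [|exact: diff_derivable..].
rewrite powE derive_gram_tr derive_gram_det /GRing.scale /= /dilation_grad.
rewrite /tr_gram /det_pow -/s.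
have -> : ahlfors (gram P) = gram P - (n%:R^-1 * \tr (gram P)) *: 1%:M.
  rewrite /ahlfors gram_sym -[gram P + _]mulr2n -[gram P *+ 2]scaler_nat scalerA.
  by rewrite mulVf ?scale1r // pnatr_eq0.
rewrite mulmxBr -mulmxA mul_adj_mx mul_mx_scalar -scalemxAr mulmx1.
rewrite [RHS]mxE [X in _ = _ * X]mxE [X in _ = _ * (X + _)]mxE.
rewrite [X in _ = _ * (_ + X)]mxE [X in _ = _ * (_ - X)]mxE.
have {1}-> : \det (gram P) `^ s = \det (gram P) `^ (s - 1) * \det (gram P).
  rewrite -[X in _ * X]powRr1 ?ltW // -powRD ?subrK //.
  by apply/implyP => _; exact: lt0r_neq0.
by rewrite /s; ring.
Qed.

Lemma dilation_PE P : 0 < \det (gram P) -> dilation_P P = dilation_grad P.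
Proof.
move=> d0; apply/matrixP => a i; rewrite mxE -derive_real_dilation //.
have near_d0 := near_gram_det_gt0 _ _ (C1_mx_at_id P) d0.
by apply: near_eq_derive; near=> Q; rewrite /= dilationE //; near: Q.
Unshelve. all: by end_near. Qed.

(** The factor [P *m \adj (gram P)] is injective: [P^T] is, up to the nonzero
   scalar [\det (gram P)], a left inverse of it. *)
Lemma rank_dilation_grad P : 0 < \det (gram P) ->
  \rank (dilation_grad P) = \rank (ahlfors (gram P)).
Proof.
move=> d0; have d_neq0 := lt0r_neq0 d0.
rewrite /dilation_grad mxrank_scale_nz; last first.
  by rewrite mulf_neq0 // ?pnatr_eq0 // lt0r_neq0 // powR_gt0.
apply/eqP; rewrite eqn_leq mxrankM_maxr /=.
rewrite -(mxrank_scale_nz (ahlfors _) d_neq0).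
have -> : \det (gram P) *: ahlfors (gram P) =
    P^T *m (P *m \adj (gram P) *m ahlfors (gram P)).
  by rewrite !mulmxA -/(gram P) mul_mx_adj mul_scalar_mx.
exact: mxrankM_maxr.
Qed.

End Gram.

(** * Lower bounds for the outer measure and the essential supremum *)

Section OuterMeasure.
Context {R : realType} {n : nat}.
Implicit Types x y : 'rV[R]_n.

Lemma lebesgue_outer_ge0 (A : set 'rV[R]_n) : (0 <= lebesgue_outer A)%E.
Proof.
apply: le_ereal_inf_tmp => _ [a [b [ab _ ->]]].
apply: nneseries_ge0 => k _ _; rewrite lee_fin.
by apply: prodr_ge0 => i _; rewrite subr_ge0.
Qed.

(** A box of volume zero needs at least one edge to be degenerate, hence [0 < n]. *)
Lemma lebesgue_outer0 : (0 < n)%N -> lebesgue_outer (set0 : set 'rV[R]_n) = 0%E.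
Proof.
move=> n0; apply/eqP; rewrite eq_le lebesgue_outer_ge0 andbT.
apply: ge_ereal_inf; exists 0%E => //; exists (fun=> 0), (fun=> 0); split => //.
rewrite eseries0 // => k _ _; rewrite /box_volume (bigD1 (Ordinal n0)) //=.
by rewrite subrr mul0r.
Qed.

Definition replace_coord x (i : 'I_n) (t : R) : 'rV[R]_n :=
  \row_j (if j == i then t else x 0 j).

(** Integrating the inequality [1 <= \sum_k 1_(box k)] over the cube one
   coordinate at a time replaces, factor by factor, the indicator function of
   an edge of each box by the length of that edge. *)
Lemma cube_cover_partial_volume (y : 'rV[R]_n) (d : R) (a b : nat -> 'rV[R]_n) :
  0 < d -> (forall k i, a k 0 i <= b k 0 i) ->
  (forall x, (forall i, y 0 i - d <= x 0 i <= y 0 i + d) ->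
     exists k, box (a k) (b k) x) ->
  forall (m : nat) x, (m <= n)%N -> (forall i, y 0 i - d <= x 0 i <= y 0 i + d) ->
  (((2 * d) ^+ m)%:E <= \sum_(0 <= k <oo)
    (\prod_(i < n) (if (i < m)%N then b k 0 i - a k 0 i
              else \1_`[a k 0 i, b k 0 i]%classic (x 0 i)))%:E)%E.
Proof.
move=> d0 ab cover.
pose F (m : nat) x k : R := \prod_(i < n) (if (i < m)%N then b k 0 i - a k 0 i
              else \1_`[a k 0 i, b k 0 i]%classic (x 0 i)).
have F_ge0 m x k : 0 <= F m x k.
  rewrite /F; apply: prodr_ge0 => i _; case: ifP => _; last by rewrite indicE.
  by rewrite subr_ge0.
elim=> [|m ih] x mn xy.
  have [k kx] := cover x xy.
  apply: (@le_trans _ _ (F 0%N x k)%:E).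
    rewrite lee_fin expr0 /F big1 // => i _.
    by rewrite indicE mem_set //= in_itv /=; exact: kx.
  apply: (le_trans _ (nneseries_lim_ge k.+1 _)); last first.
    by move=> j _ _; rewrite lee_fin; exact: (F_ge0 0%N x j).
  rewrite big_nat_recr //= leeDr //; apply: sume_ge0 => j _.
  by rewrite lee_fin; exact: (F_ge0 0%N x j).
pose i0 := Ordinal mn.
pose c k := \prod_(i < n | i != i0) (if (i < m)%N then b k 0 i - a k 0 i
              else \1_`[a k 0 i, b k 0 i]%classic (x 0 i)).
have c_ge0 k : 0 <= c k.
  rewrite /c; apply: prodr_ge0 => i _; case: ifP => _; last by rewrite indicE.
  by rewrite subr_ge0.
have FmE t k : F m (replace_coord x i0 t) k =
    c k * \1_`[a k 0 i0, b k 0 i0]%classic t.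
  rewrite /F (bigD1 i0) //= ltnn mxE eqxx mulrC; congr (_ * _).
  by apply: eq_bigr => i /negPf ii0; rewrite mxE ii0.
have FSE k : F m.+1 x k = c k * (b k 0 i0 - a k 0 i0).
  rewrite /F (bigD1 i0) //= ltnSn mulrC; congr (_ * _).
  apply: eq_bigr => i ii0; rewrite ltnS leq_eqVlt.
  by rewrite -(inj_eq val_inj) /= in ii0; rewrite (negPf ii0).
pose T := `[y 0 i0 - d, y 0 i0 + d]%classic : set R.
have mT : measurable T by exact: measurable_itv.
have ineq t : T t -> (((2 * d) ^+ m)%:E <=
    \sum_(0 <= k <oo) (c k * \1_`[a k 0 i0, b k 0 i0]%classic t)%:E)%E.
  rewrite /T /= in_itv /= => tT.
  under eq_eseriesr do rewrite -FmE.
  apply: ih; first exact: ltnW.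
  by move=> i; rewrite mxE; case: eqP => [->|].
have mI (k : nat) : measurable (`[a k 0 i0, b k 0 i0]%classic : set R).
  exact: measurable_itv.
have mind1 (k : nat) :
    measurable_fun T (\1_`[a k 0 i0, b k 0 i0]%classic : R -> R).
  by apply: measurable_indic; exact: measurable_itv.
have mind (k : nat) :
    measurable_fun T (fun t : R => c k * \1_`[a k 0 i0, b k 0 i0]%classic t : R).
  by apply: measurable_funM; first exact: measurable_cst.
have ind_ge0 (k : nat) t : T t ->
    (0 <= (c k * \1_`[a k 0 i0, b k 0 i0]%classic t)%:E :> \bar R)%E.
  by move=> _; rewrite lee_fin mulr_ge0 // indicE.
have step : (\int[lebesgue_measure]_(t in T) (cst ((2 * d) ^+ m)%:E t) <=
    \int[lebesgue_measure]_(t in T)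
      \sum_(0 <= k <oo) (c k * \1_`[a k 0 i0, b k 0 i0]%classic t)%:E)%E.
  apply: ge0_le_integral => //.
  - by move=> t _; rewrite lee_fin exprn_ge0 // mulr_ge0 // ltW.
  - apply: ge0_emeasurable_sum => [k t Tt _|k _]; first exact: ind_ge0.
    by apply/measurable_EFinP; exact: mind.
rewrite integral_cst // integral_nneseries // in step; last first.
  by move=> k; apply/measurable_EFinP; exact: mind.
have muT : lebesgue_measure T = (2 * d)%:E.
  rewrite /T lebesgue_measure_itv /= lte_fin ltrD2l gtrN // -EFinB; congr (_%:E).
  by ring.
rewrite [X in (_ * X <= _)%E]muT -EFinM -exprSr in step; apply: (le_trans step).
apply: lee_nneseries => [k _ _|k _]; first by apply: integral_ge0; exact: ind_ge0.
under eq_integral do rewrite EFinM.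
rewrite ge0_integralZl_EFin //; last first.
  by apply/measurable_EFinP; exact: mind1.
rewrite integral_indic // -[leRHS]/((F m.+1 x k)%:E) FSE EFinM; apply: lee_pmul => //.
- by rewrite lee_fin.
- apply: (@le_trans _ _ (lebesgue_measure (`[a k 0 i0, b k 0 i0]%classic : set R))).
    apply: le_measure; rewrite ?inE //.
    by apply: measurableI => //; exact: mI.
  rewrite lebesgue_measure_itv /=; case: ifP => // _.
  by rewrite lee_fin subr_ge0.
Qed.

Lemma lebesgue_outer_cube_gt0 (A : set 'rV[R]_n) (y : 'rV[R]_n) (d : R) : 0 < d ->
  (forall x, (forall i, y 0 i - d <= x 0 i <= y 0 i + d) -> A x) ->
  (0 < lebesgue_outer A)%E.
Proof.
move=> d0 cubeA; apply: (@lt_le_trans _ _ ((2 * d) ^+ n)%:E).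
  by rewrite lte_fin exprn_gt0 // mulr_gt0.
apply: le_ereal_inf_tmp => _ [a [b [ab Ab ->]]].
have cov x : (forall i, y 0 i - d <= x 0 i <= y 0 i + d) -> exists k, box (a k) (b k) x.
  by move=> /cubeA/Ab [k _ kx]; exists k.
have yy i : y 0 i - d <= y 0 i <= y 0 i + d.
  by rewrite lerBlDr lerDl ltW.
apply: (le_trans (cube_cover_partial_volume _ _ _ _ d0 ab cov n y (leqnn n) yy)).
apply: lee_nneseries => [k _ _|k _].
  rewrite lee_fin; apply: prodr_ge0 => i _; case: ifP => _; last by rewrite indicE.
  by rewrite subr_ge0.
by rewrite lee_fin; under eq_bigr => i _ do rewrite ltn_ord.
Qed.

Lemma Linfty_norm_le (D : set 'rV[R]_n) (F : 'rV[R]_n -> \bar R) (c : R) :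
  (0 < n)%N -> 0 <= c -> (forall x, D x -> (F x <= c%:E)%E) ->
  (Linfty_norm D F <= c%:E)%E.
Proof.
move=> n0 c0 Fc; apply: ge_ereal_inf; exists c%:E => //; split; first by rewrite lee_fin.
rewrite (_ : [set x | _] = set0) ?lebesgue_outer0 //.
apply/seteqP; split => // x /= [Dx]; apply/negP; rewrite -leNgt; exact: Fc.
Qed.

(** A continuous function exceeds any value below its value at a point of the
   closure on a whole ball inside [D], which is not a null set. *)
Lemma Linfty_norm_ge (D : set 'rV[R]_n) (F : 'rV[R]_n -> \bar R)
    (k : 'rV[R]_n -> R) x :
  open D -> closure D x -> {for x, continuous k} ->
  (forall y, D y -> F y = (k y)%:E) -> ((k x)%:E <= Linfty_norm D F)%E.
Proof.
move=> oD Dx ck Fk; apply: le_ereal_inf_tmp => c [c0 outer0].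
rewrite leNgt; apply/negP => ckx.
have c_fin : c = (fine c)%:E.
  by rewrite fineK // fin_numE; case: (c) c0 ckx => [r||] //.
have near_ck : \forall y \near x, fine c < k y.
  have ck' : fine c < k x by rewrite -lte_fin -c_fin.
  exact: cvgr_gt ck _ ck'.
have [y [Dy ycky]] := Dx _ (nbhs_interior near_ck).
have : nbhs y (D `&` [set z | fine c < k z]).
  by apply: filterI => //; apply: open_nbhs_nbhs.
move=> /nbhs_ballP [e /= e0 eA].
suff : (0 < lebesgue_outer [set z | D z /\ (c < F z)%E])%E by rewrite outer0 ltxx.
apply: (@lebesgue_outer_cube_gt0 _ y (e / 2)); first by rewrite divr_gt0.
move=> z zy; have [Dz kz] : (D `&` [set z | fine c < k z]) z.
  apply: eA; split => // i j; rewrite ord1 /ball /=.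
  rewrite distrC ltr_norml; have := zy j; lra.
by split => //; rewrite Fk // c_fin lte_fin.
Qed.

End OuterMeasure.

(** * Lowering the maximal dilation by a first variation *)

Section Gradient.
Context {R : realType} {n : nat}.

Lemma derive_sum_partial {V : normedModType R} (f : 'rV[R]_n -> V) x v : differentiable f x ->
  'D_v f x = \sum_i v 0 i *: partial i f x.
Proof.
move=> df; rewrite deriveE // {1}(row_sum_delta v) linear_sum.
by apply: eq_bigr => i _; rewrite linearZ /= -deriveE.
Qed.

Lemma C1_mx_at_of_C1 {N} (W : set 'rV[R]_n) (f : 'rV[R]_n -> 'rV[R]_N) x :
  open W -> C1 W f -> W x -> C1_mx_at f x.
Proof.
move=> oW Cf Wx i j; have nW : \forall y \near x, W y by exact: open_nbhs_nbhs.
split.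
  near=> y; apply: differentiable_mx_coord.
  by apply: (Cf y _).1; near: y.
move=> v.
have e : {near x, (fun y => \sum_k v 0 k * partial k f y i j)
                   =1 'D_v (fun y => f y i j)}.
  near=> y; have dfy : differentiable f y by apply: (Cf y _).1; near: y.
  rewrite derive_mx_coord // derive_sum_partial // summxE.
  by apply: eq_bigr => k _; rewrite mxE.
rewrite /prop_for /continuous_at -(nbhs_singleton e).
apply: cvg_trans (near_eq_cvg e) _.
apply: cvg_big => //; first exact: add_continuous.
move=> k _; apply: cvgM; first exact: cvg_cst.
apply: (cvg_comp (partial k f) (fun A => A i j) ((Cf x Wx).2 k)).
exact: coord_continuous.
Unshelve. all: by end_near. Qed.

Lemma C1_of_C1_mx_at {N} (W : set 'rV[R]_n) (f : 'rV[R]_n -> 'rV[R]_N) :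
  (forall x, W x -> C1_mx_at f x) -> C1 W f.
Proof.
move=> Cf x Wx.
have near_df : \forall y \near x, differentiable f y.
  have : \forall y \near x, forall i j, differentiable (fun z => f z i j) y.
    apply: (@filter_forall _ _ 
      (fun i y => forall j, differentiable (fun z => f z i j) y) (nbhs x)) => i.
    apply: (@filter_forall _ _ 
      (fun j y => differentiable (fun z => f z i j) y) (nbhs x)) => j.
    by have [] := Cf x Wx i j.
  by apply: filterS => y dy; exact: differentiable_mx.
split; first exact: nbhs_singleton near_df.
move=> k; apply: continuous_mx => i j.
have e : {near x, 'D_(delta_mx 0 k) (fun y => f y i j) =1 (fun y => partial k f y i j)}.
  by near=> y; rewrite /partial -derive_mx_coord //; near: y.
rewrite /prop_for /continuous_at -(nbhs_singleton e).
apply: cvg_trans (near_eq_cvg e) _.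
exact: (Cf x Wx i j).2.
Unshelve. all: by end_near. Qed.

(** The same matrix as [grad] at points of differentiability ([gradE]), but with
   entries that are partial derivatives everywhere, so that its regularity is
   literally the one of the partial derivatives. *)
Definition partials {N} (u : 'rV[R]_n -> 'rV[R]_N) (x : 'rV[R]_n) : 'M[R]_(N, n) :=
  \matrix_(a, i) partial i u x 0 a.

Lemma gradE {N} (u : 'rV[R]_n -> 'rV[R]_N) x : differentiable u x ->
  grad u x = partials u x.
Proof.
by move=> du; apply/matrixP => a i; rewrite !mxE /partial deriveE.
Qed.

Lemma partials_continuous {N} (W : set 'rV[R]_n) (f : 'rV[R]_n -> 'rV[R]_N) x :
  C1 W f -> W x -> {for x, continuous (partials f)}.
Proof.
move=> Cf Wx; apply: continuous_mx => a i.
rewrite (_ : (fun y => partials f y a i) = (fun y => partial i f y 0 a)); last first.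
  by apply/funext => y; rewrite mxE.
apply: (cvg_comp (partial i f) (fun A => A 0 a) ((Cf x Wx).2 i)).
exact: coord_continuous.
Qed.

Lemma grad_perturbed {N} (u w : 'rV[R]_n -> 'rV[R]_N) x (e : R) :
  differentiable u x -> differentiable w x ->
  grad (fun y => u y + e *: w y) x = partials u x + e *: partials w x.
Proof.
move=> du dw.
have dew : differentiable (e *: w) x by exact: differentiableZ.
rewrite gradE; last exact: (differentiableD du dew).
apply/matrixP => a i; rewrite !mxE /partial.
rewrite -[LHS]/('D_(delta_mx 0 i) (u + e *: w) x 0 a).
by rewrite deriveD ?deriveZ ?mxE //; exact: diff_derivable.
Qed.

End Gradient.

Section Descent.
Context {R : realType} {n N : nat}.
Implicit Types P Q : 'M[R]_(N, n).

Definition frobdot P Q : R := \sum_a \sum_i P a i * Q a i.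

Lemma cvg_frobdot {T : Type} {F : set_system T} {FF : Filter F}
    (G H : T -> 'M[R]_(N, n)) P Q :
  G @ F --> P -> H @ F --> Q -> frobdot (G t) (H t) @[t --> F] --> frobdot P Q.
Proof.
move=> GP HQ.
have coord A (l : 'M[R]_(N, n)) a i : A @ F --> l -> A t a i @[t --> F] --> l a i.
  by move=> Al; apply: (cvg_comp A (fun B => B a i) Al); exact: coord_continuous.
apply: cvg_big => //; first exact: add_continuous.
move=> a _; apply: cvg_big => //; first exact: add_continuous.
by move=> i _; apply: cvgM; exact: coord.
Qed.

Lemma continuous_frobdot {T : topologicalType} (G H : T -> 'M[R]_(N, n)) (x : T) :
  {for x, continuous G} -> {for x, continuous H} ->
  {for x, continuous (fun t => frobdot (G t) (H t))}.
Proof. exact: cvg_frobdot. Qed.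

Lemma real_dilation_line P Q (t : R) : 0 < \det (gram (P + t *: Q)) ->
  is_derive t (1 : R) (fun s => real_dilation (P + s *: Q))
    (frobdot (dilation_grad (P + t *: Q)) Q).
Proof.
move=> d0.
have Cid := C1_at_id t.
have CL : C1_mx_at (fun s : R => P + s *: Q) t.
  by apply: C1_mx_atD; [|apply: C1_mx_atZ => //]; exact: C1_mx_at_cst.
have dL : differentiable (fun s : R => P + s *: Q) t.
  by apply: differentiable_mx => a i; exact: C1_at_differentiable (CL a i).
have dK : differentiable (@real_dilation R n N) (P + t *: Q).
  apply: C1_at_differentiable.
  exact: C1_at_real_dilation _ _ (C1_mx_at_id _) d0.
split; first exact/diff_derivable/(differentiable_comp dL dK).
rewrite derive_comp_mx //; apply: eq_bigr => a _; apply: eq_bigr => i _.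
rewrite derive_real_dilation //; congr (_ * _).
under eq_fun do rewrite !mxE.
rewrite (@deriveD _ _ _ (cst (P a i)) (fun s : R => s * Q a i)).
- rewrite derive_cst add0r (@deriveM _ _ id (cst (Q a i))).
  + by rewrite derive_id derive_cst scaler0 add0r /GRing.scale /= mulr1.
  + exact: derivable_id.
  + exact: derivable_cst.
- exact: derivable_cst.
- by apply: derivableM; [exact: derivable_id|exact: derivable_cst].
Qed.

Lemma real_dilation_continuous {T : topologicalType} (G H : T -> 'M[R]_(N, n))
    (x : T) (e : R) :
  {for x, continuous G} -> {for x, continuous H} ->
  0 < \det (gram (G x + e *: H x)) ->
  {for x, continuous (fun t => real_dilation (G t + e *: H t))}.
Proof.
move=> cG cH d0; have cP : {for x, continuous (fun t => G t + e *: H t)}.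
  by apply: cvgD cG _; apply: cvgZ cH; exact: cvg_cst.
apply: (continuous_comp cP).
exact: C1_at_continuous (C1_at_real_dilation _ _ (C1_mx_at_id _) d0).
Qed.

(** Where the dilation equals [M], the first variation stays negative for nearby
   points and small parameters, so the mean value theorem gives a decrease with
   a step that does not depend on the point; elsewhere continuity suffices. *)
Lemma real_dilation_local_descent {T : topologicalType} (G H : T -> 'M[R]_(N, n))
    (x : T) (M : R) :
  {for x, continuous G} -> {for x, continuous H} -> 0 < \det (gram (G x)) ->
  real_dilation (G x) <= M ->
  (real_dilation (G x) = M -> frobdot (dilation_grad (G x)) (H x) < 0) ->
  \forall y \near x & e \near (0 : R)^'+, real_dilation (G y) <= M ->
    0 < \det (gram (G y + e *: H y)) /\ real_dilation (G y + e *: H y) < M.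
Proof.
move=> cG cH d0 leM decr.
have cfst : fst @ (x, (0 : R)) --> x by exact: cvg_fst.
have cL : (fun p : T * R => G p.1 + p.2 *: H p.1) @ (x, (0 : R)) --> G x.
  rewrite -[X in _ --> X]addr0 -(scale0r (H x)); apply: cvgD.
    exact: (cvg_comp fst G cfst cG).
  apply: cvgZ; first exact: cvg_snd.
  exact: (cvg_comp fst H cfst cH).
have Cid := C1_mx_at_id (G x).
have cdet : {for G x, continuous (fun Q => \det (gram Q))}.
  exact: C1_at_continuous (C1_at_gram_det _ _ Cid).
have near_det : \forall p \near (x, (0 : R)), 0 < \det (gram (G p.1 + p.2 *: H p.1)).
  exact: cvgr_gt (cvg_comp _ _ cL cdet) _ d0.
have cK : {for G x, continuous (@real_dilation R n N)}.
  exact: C1_at_continuous (C1_at_real_dilation _ _ Cid d0).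
move: leM; rewrite le_eqVlt => /orP[/eqP eqM|ltM]; last first.
  have near_lt : \forall p \near (x, (0 : R)), real_dilation (G p.1 + p.2 *: H p.1) < M.
    exact: cvgr_lt (cvg_comp _ _ cL cK) _ ltM.
  have [[U V] /= [Ux V0] UV] : nbhs (x, (0 : R)) [set p |
      0 < \det (gram (G p.1 + p.2 *: H p.1)) /\
      real_dilation (G p.1 + p.2 *: H p.1) < M] by exact: filterI.
  exists (U, V) => /=; first by split => //; exact: cvg_within V0.
  by move=> [y e] /= yUeV _; exact: (UV (y, e)).
have cD : {for G x, continuous (@dilation_grad R n N)}.
  exact: C1_mx_at_continuous (C1_mx_at_dilation_grad _ _ Cid d0).
have near_neg : \forall p \near (x, (0 : R)),
    frobdot (dilation_grad (G p.1 + p.2 *: H p.1)) (H p.1) < 0.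
  have cdot : (fun p => frobdot (dilation_grad (G p.1 + p.2 *: H p.1)) (H p.1))
      @ (x, (0 : R)) --> frobdot (dilation_grad (G x)) (H x).
    apply: cvg_frobdot; first exact: (cvg_comp _ _ cL cD).
    exact: (cvg_comp fst H cfst cH).
  exact: cvgr_lt cdot _ (decr eqM).
have [[U V] /= [Ux V0] UV] : nbhs (x, (0 : R)) [set p |
    0 < \det (gram (G p.1 + p.2 *: H p.1)) /\
    frobdot (dilation_grad (G p.1 + p.2 *: H p.1)) (H p.1) < 0].
  exact: filterI.
move: V0 => /nbhs_ballP[d /= dgt0 dV].
exists (U, [set e | 0 < e < d]) => /=.
  split => //; near=> e; apply/andP; split; near: e.
    exact: nbhs_right_gt.
  exact: nbhs_right_lt.
move=> [y e] /= [Uy /andP[e0 ed]] Gy.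
have UVt t : 0 <= t <= e -> 0 < \det (gram (G y + t *: H y)) /\
    frobdot (dilation_grad (G y + t *: H y)) (H y) < 0.
  move=> /andP[t0 te]; apply: (UV (y, t)); split => //; apply: dV.
  by rewrite /ball /= sub0r normrN ger0_norm // (le_lt_trans te).
split; first by apply: (UVt e _).1; rewrite ltW //=.
pose phi (t : R) := real_dilation (G y + t *: H y).
have dphi t : 0 <= t <= e ->
    is_derive t (1 : R) phi (frobdot (dilation_grad (G y + t *: H y)) (H y)).
  by move=> te; apply: real_dilation_line; exact: (UVt t te).1.
have [||c ce] := @MVT R phi (fun t => frobdot (dilation_grad (G y + t *: H y)) (H y)) 0 e e0.
- by move=> t; rewrite in_itv /= => /andP[t0 te]; apply: dphi; rewrite !ltW.
- apply: derivable_within_continuous => t; rewrite in_itv /= => te.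
  by have [] := dphi t te.
rewrite in_itv /= in ce; case/andP: ce => c0 ce.
rewrite subr0 /phi scale0r addr0 => phiE.
have [|_ neg] := UVt c; first by rewrite !ltW.
apply: (lt_le_trans _ Gy); rewrite -subr_lt0 phiE.
by rewrite pmulr_llt0.
Unshelve. all: by end_near. Qed.

Lemma real_dilation_uniform_descent {T : topologicalType}
    (G H : T -> 'M[R]_(N, n)) (K : set T) (M : R) : compact K ->
  (forall x, K x -> {for x, continuous G}) ->
  (forall x, K x -> {for x, continuous H}) ->
  (forall x, K x -> 0 < \det (gram (G x))) ->
  (forall x, K x -> real_dilation (G x) <= M) ->
  (forall x, K x -> real_dilation (G x) = M ->
     frobdot (dilation_grad (G x)) (H x) < 0) ->
  \forall e \near (0 : R)^'+, K `<=` [set y |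
    0 < \det (gram (G y + e *: H y)) /\ real_dilation (G y + e *: H y) < M].
Proof.
move=> /compact_near_coveringP/near_covering_withinP cK cG cH det0 leM decr.
apply: cK => x Kx.
have [[U V] /= UV UVQ] := real_dilation_local_descent G H x M
  (cG x Kx) (cH x Kx) (det0 x Kx) (leM x Kx) (decr x Kx).
by exists (U, V) => //= -[y e] /= UVye Ky; exact: (UVQ (y, e) UVye (leM y Ky)).
Qed.

(** First-order decrease at the maximum points of the dilation is enough:
   compactness makes the step uniform, and elsewhere the dilation is already
   below its maximum. *)
Lemma K_infty_descent (n_gt0 : (0 < n)%N) (W D : set 'rV[R]_n)
    (u w : 'rV[R]_n -> 'rV[R]_N) :
  C1 W u -> C1 W w -> (forall x, W x -> 0 < \det (gram (partials u x))) ->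
  open D -> D !=set0 -> compact (closure D) -> closure D `<=` W ->
  (forall x, closure D x ->
    (forall y, closure D y ->
       real_dilation (partials u y) <= real_dilation (partials u x)) ->
    frobdot (dilation_grad (partials u x)) (partials w x) < 0) ->
  exists2 e : R, 0 < e & (K_infty (fun x => u x + e *: w x)%R D < K_infty u D)%E.
Proof.
move=> Cu Cw det0 oD [x0 Dx0] cD DW decr.
have D0 : closure D !=set0 by exists x0; exact: subset_closure.
have cK x : W x -> {for x, continuous (fun y => real_dilation (partials u y))}.
  move=> Wx; apply: (continuous_comp (partials_continuous _ _ _ Cu Wx)).
  exact: C1_at_continuous (C1_at_real_dilation _ _ (C1_mx_at_id _) (det0 x Wx)).
have cKD : {in closure D, continuous (fun y => real_dilation (partials u y))}.
  by move=> x; rewrite inE => /DW; exact: cK.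
have [M [x1 x1D x1M] maxM] : exists2 M, exists2 x1, closure D x1 &
      real_dilation (partials u x1) = M &
    forall t, closure D t -> real_dilation (partials u t) <= M.
  have [x1 x1D maxx1] := compact_EVT_max D0 cD (continuous_in_subspaceT cKD).
  exists (real_dilation (partials u x1)).
    by exists x1 => //; rewrite inE in x1D.
  by move=> t Dt; apply: maxx1; rewrite inE.
have H1 x : closure D x -> {for x, continuous (partials u)}.
  by move=> Dx; exact: partials_continuous Cu (DW x Dx).
have H2 x : closure D x -> {for x, continuous (partials w)}.
  by move=> Dx; exact: partials_continuous Cw (DW x Dx).
pose Q (e : R) y := 0 < \det (gram (partials u y + e *: partials w y)) /\
  real_dilation (partials u y + e *: partials w y) < M.
have [e [e0 eQ]] : exists e : R, 0 < e /\ closure D `<=` Q e.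
  have nearQ : \forall e \near (0 : R)^'+, closure D `<=` Q e.
    have H3 x : closure D x -> 0 < \det (gram (partials u x)).
      by move=> Dx; exact: det0 x (DW x Dx).
    have H4 x : closure D x -> real_dilation (partials u x) = M ->
        frobdot (dilation_grad (partials u x)) (partials w x) < 0.
      by move=> Dx xM; apply: (decr x Dx) => y Dy; rewrite xM; exact: maxM.
    exact: real_dilation_uniform_descent cD H1 H2 H3 maxM H4.
  near (0 : R)^'+ => e; exists e; split; last by near: e.
  near: e; exact: nbhs_right_gt.
exists e => //.
have duD x : W x -> differentiable u x /\ differentiable w x.
  by move=> Wx; split; [exact: (Cu x Wx).1|exact: (Cw x Wx).1].
have cL x : closure D x ->
    {for x, continuous (fun t => real_dilation (partials u t + e *: partials w t))}.
  by move=> Dx; exact: (real_dilation_continuous _ _ _ _ (H1 x Dx) (H2 x Dx) (eQ x Dx).1).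
have cLD : {in closure D, continuous
    (fun t => real_dilation (partials u t + e *: partials w t))}.
  by move=> x; rewrite inE; exact: cL.
have [x2 x2D maxx2] := compact_EVT_max D0 cD (continuous_in_subspaceT cLD).
rewrite inE in x2D.
apply: (@le_lt_trans _ _ (real_dilation (partials u x2 + e *: partials w x2))%:E).
  apply: Linfty_norm_le => //; first exact: real_dilation_ge0.
  move=> x Dx; have cDx := subset_closure Dx; have [du dw] := duD x (DW x cDx).
  rewrite grad_perturbed // dilationE; last exact: (eQ x cDx).1.
  by rewrite lee_fin; apply: maxx2; rewrite inE.
apply: (@lt_le_trans _ _ M%:E); first by rewrite lte_fin; exact: (eQ x2 x2D).2.
rewrite -x1M.
apply: (@Linfty_norm_ge _ _ _ _ (fun y => real_dilation (partials u y))) => //.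
  exact/cK/DW.
move=> y Dy; have Wy := DW y (subset_closure Dy).
by rewrite gradE ?dilationE //; [exact: det0|exact: (duD y Wy).1].
Unshelve. all: by end_near. Qed.

End Descent.

(** * Maxima over Euclidean balls *)

Section Balls.
Context {R : realType} {n : nat}.
Implicit Types x y d : 'rV[R]_n.

(** The squared Euclidean distance; the ambient norm is the maximum norm, whose
   balls have corners where the outward direction is not unique. *)
Definition sqdist x y : R := \sum_i (y 0 i - x 0 i) ^+ 2.

Definition euclidean_ball x (rho : R) : set 'rV[R]_n := [set y | sqdist x y < rho].

Lemma C1_at_sqdist x y : C1_at (sqdist x) y.
Proof.
apply: C1_at_sum => i _; under eq_fun do rewrite expr2.
have CB : C1_at (fun z : 'rV[R]_n => z 0 i - x 0 i) y.
  by apply: C1_atD; [exact: C1_mx_at_id|exact: C1_at_cst].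
exact: C1_atM.
Qed.

Lemma derive_sqdist x y d : 'D_d (sqdist x) y = 2 * \sum_i (y 0 i - x 0 i) * d 0 i.
Proof.
have CB i : C1_at (fun z : 'rV[R]_n => z 0 i - x 0 i) y.
  by apply: C1_atD; [exact: C1_mx_at_id|exact: C1_at_cst].
have dB i := C1_at_differentiable (CB i).
rewrite derive_bigsum; last first.
  by move=> i _; under eq_fun do rewrite expr2; apply: differentiableM.
rewrite mulr_sumr; apply: eq_bigr => i _.
have dBE : 'D_d (fun z : 'rV[R]_n => z 0 i - x 0 i) y = d 0 i.
  rewrite (@deriveB _ _ _ (fun z : 'rV[R]_n => z 0 i) (cst (x 0 i))).
  - by rewrite derive_cst subr0 (derive_mx_coord id) ?derive_id.
  - by apply: diff_derivable; exact: differentiable_coord.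
  - exact: derivable_cst.
under eq_fun do rewrite expr2.
rewrite (@deriveM _ _ (fun z : 'rV[R]_n => z 0 i - x 0 i)
                      (fun z : 'rV[R]_n => z 0 i - x 0 i)).
- by rewrite dBE /GRing.scale /=; ring.
- exact: diff_derivable.
- exact: diff_derivable.
Qed.

Lemma open_euclidean_ball x rho : open (euclidean_ball x rho).
Proof.
apply: (@open_comp _ _ (sqdist x) [set t | t < rho]); last exact: open_lt.
by move=> y _; exact: C1_at_continuous (C1_at_sqdist x y).
Qed.

Lemma closure_euclidean_ball x rho :
  closure (euclidean_ball x rho) `<=` [set y | sqdist x y <= rho].
Proof.
have cl : closed [set y | sqdist x y <= rho].
  apply: (@closed_comp _ _ (sqdist x) [set t | t <= rho]); last exact: closed_le.
  by move=> y _; exact: C1_at_continuous (C1_at_sqdist x y).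
rewrite [X in _ `<=` X](closure_id _).1 //.
by apply: closure_subset => y /ltW.
Qed.

Lemma euclidean_ball_center x rho : 0 < rho -> euclidean_ball x rho x.
Proof.
by move=> rho0; rewrite /euclidean_ball /= /sqdist big1 // => i _; rewrite subrr expr0n.
Qed.

Lemma small_euclidean_ball x (U : set 'rV[R]_n) : nbhs x U ->
  exists rho, [/\ 0 < rho, compact (closure (euclidean_ball x rho)) &
    closure (euclidean_ball x rho) `<=` U].
Proof.
move=> /nbhs_ballP[e /= e0 eU]; exists ((e / 2) ^+ 2).
have e20 : 0 < e / 2 by rewrite divr_gt0.
have coord y i : sqdist x y <= (e / 2) ^+ 2 -> x 0 i - e / 2 <= y 0 i <= x 0 i + e / 2.
  move=> yr; have : (y 0 i - x 0 i) ^+ 2 <= (e / 2) ^+ 2.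
    apply: le_trans yr; rewrite /sqdist (bigD1 i) //= lerDl.
    by apply: sumr_ge0 => j _; exact: sqr_ge0.
  move=> sq; rewrite lerBlDr -lerBlDl; apply/andP; split; nra.
have clE := closure_euclidean_ball x ((e / 2) ^+ 2).
split; first by rewrite exprn_gt0.
  apply: (@subclosed_compact _ _ [set v : 'rV[R]_n | forall i,
      `[x 0 i - e / 2, x 0 i + e / 2]%classic (v 0 i)]).
  - exact: closed_closure.
  - apply: (@rV_compact _ n (fun i => `[x 0 i - e / 2, x 0 i + e / 2]%classic)) => i.
    exact: segment_compact.
  - by move=> y /clE /= yr i; rewrite /= in_itv /=; exact: coord.
move=> y /clE /= yr; apply: eU; split => // i j; rewrite ord1 /ball /=.
rewrite distrC ltr_norml; have := coord y j yr; lra.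
Qed.

Lemma increase_along_derivative (k : 'rV[R]_n -> R) x d : derivable k x d ->
  0 < 'D_d k x -> \forall t \near (0 : R)^'+, k x < k (t *: d + x).
Proof.
move=> dk k0.
have cquot : (fun t : R => t^-1 *: (k (t *: d + x) - k x)) @ (0 : R)^'+ --> 'D_d k x.
  exact: cvg_dnbhs_at_right dk.
have quot_gt0 : \forall t \near (0 : R)^'+, 0 < t^-1 *: (k (t *: d + x) - k x).
  exact: cvgr_gt cquot _ k0.
near=> t; have t0 : 0 < t by near: t; exact: nbhs_right_gt.
have : 0 < t^-1 *: (k (t *: d + x) - k x) by near: t.
by rewrite /GRing.scale /= pmulr_rgt0 ?invr_gt0 // subr_gt0.
Unshelve. all: by end_near. Qed.

(** At a maximum point [y] of [k] over the ball, a direction [q] of increase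
   of [k] points outwards: otherwise [q], slightly tilted towards the center,
   would enter the ball while still increasing [k]. *)
Lemma max_on_ball_outward (k : 'rV[R]_n -> R) x y q (rho : R) : 0 < rho ->
  differentiable k y -> 0 < 'D_q k y -> sqdist x y <= rho ->
  (forall z, closure (euclidean_ball x rho) z -> k z <= k y) ->
  0 < \sum_i q 0 i * (y 0 i - x 0 i).
Proof.
move=> rho0 dk qk yrho maxy; rewrite ltNge; apply/negP => le0.
(* A tilt [s] so small that [q - s (y - x)] still increases [k]; any [s] will do
   when moving towards [x] increases [k]. *)
have [s [s0 sk]] : exists s : R, 0 < s /\ 0 < 'D_(q - s *: (y - x)) k y.
  have [neg|pos] := ltP ('D_(y - x) k y) 0.
    exists 1; split => //; rewrite scale1r deriveE // linearB /= -!deriveE //.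
    by rewrite subr_gt0 (lt_trans neg).
  have den : 0 < 'D_(y - x) k y + 1 by rewrite ltr_wpDl.
  exists ('D_q k y / (2 * ('D_(y - x) k y + 1))).
  split; first by rewrite divr_gt0 // mulr_gt0.
  rewrite deriveE // linearB linearZ /= -!deriveE //.
  rewrite subr_gt0 /GRing.scale /= mulrAC ltr_pdivrMr ?mulr_gt0 //.
  by rewrite ltr_pM2l //; lra.
set d := q - s *: (y - x) in sk.
have near_up := increase_along_derivative k y d (diff_derivable dk) sk.
have near_in : \forall t \near (0 : R)^'+, euclidean_ball x rho (t *: d + y).
  have Cs := C1_at_sqdist x y.
  have near_line (P : set 'rV[R]_n) : nbhs y P -> \forall t \near (0 : R)^'+, P (t *: d + y).
    have cl : (fun t : R => t *: d + y) @ (0 : R)^'+ --> y.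
      apply: cvg_at_right_filter; rewrite -[X in _ --> X]add0r -(scale0r d).
      by apply: cvgD; [apply: cvgZ; [exact: cvg_id|exact: cvg_cst]|exact: cvg_cst].
    exact: cl.
  move: yrho; rewrite le_eqVlt => /orP[/eqP yE|]; last first.
    move=> yin; apply: near_line; apply: open_nbhs_nbhs; split => //.
    exact: open_euclidean_ball.
  (* On the sphere the tilt makes the derivative of [sqdist x] along [d]
     strictly negative. *)
  have : \forall t \near (0 : R)^'+, - sqdist x y < - sqdist x (t *: d + y).
    apply: (increase_along_derivative (fun z => - sqdist x z)).
      by apply: diff_derivable; exact: C1_at_differentiable (C1_atN _ _ Cs).
    rewrite (@deriveN _ _ _ (sqdist x)); last exact: diff_derivable (C1_at_differentiable Cs).
    rewrite derive_sqdist oppr_gt0 pmulr_rlt0 //.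
    under eq_bigr => i _ do rewrite !mxE mulrBr mulrCA -expr2 [_ * q _ _]mulrC.
    rewrite big_split /= sumrN -mulr_sumr -/(sqdist x y) yE.
    by rewrite (le_lt_trans (_ : _ <= 0 - s * rho)) ?lerD2r // sub0r oppr_lt0 mulr_gt0.
  by apply: filterS => t; rewrite ltrN2 yE.
have [t [tup tin]] : exists t : R, k y < k (t *: d + y) /\ euclidean_ball x rho (t *: d + y).
  by near (0 : R)^'+ => t; exists t; split; near: t.
by move: tup; rewrite ltNge maxy //; exact: subset_closure.
Unshelve. all: by end_near. Qed.

End Balls.

(** * The tangential system *)

Section SecondDerivatives.
Context {R : realType} {n N : nat}.
Context (W : set 'rV[R]_n) (u : 'rV[R]_n -> 'rV[R]_N)
  (oW : open W) (Cu : C2 W u).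

Lemma C1_mx_at_partials x : W x -> C1_mx_at (partials u) x.
Proof.
move=> Wx a i.
rewrite (_ : (fun y => partials u y a i) = (fun y => partial i u y 0 a)).
  exact: (C1_mx_at_of_C1 W (partial i u) x oW (Cu.2 i) Wx 0 a).
by apply/funext => y; rewrite mxE.
Qed.

Lemma partial_comp_partials (F : 'M[R]_(N, n) -> R) x i : W x ->
  differentiable F (partials u x) ->
  partial i (fun y => F (partials u y)) x =
  \sum_b \sum_j 'D_(delta_mx b j) F (partials u x) * partial i (partial j u) x 0 b.
Proof.
move=> Wx dF; have CP := C1_mx_at_partials x Wx.
rewrite /partial derive_comp_mx //; last first.
  by apply: differentiable_mx => a j; exact: C1_at_differentiable (CP a j).
apply: eq_bigr => b _; apply: eq_bigr => j _; congr (_ * _).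
rewrite -derive_mx_coord; last exact: ((Cu.2 j) x Wx).1.
suff -> : (fun y => partials u y b j) = (fun y => partial j u y 0 b) by [].
by apply/funext => y; rewrite mxE.
Qed.

End SecondDerivatives.

Section TangentialSystem.
Context {R : realType} {n N : nat}.

Lemma frobnorm_delta (a : 'I_N) : frobnorm (delta_mx 0 a : 'rV[R]_N) = 1.
Proof.
rewrite /frobnorm mxtrace_mulC /mxtrace big_ord1 mulmx_trE (bigD1 a) //= big1.
  by rewrite mxE !eqxx expr1n addr0 sqrtr1.
by move=> b /negPf ba; rewrite mxE ba andbF expr0n.
Qed.

(** The paraboloid over the ball of squared radius [rho], with values on the line
   of [e_a]. *)
Definition ball_bump (sigma rho : R) (x : 'rV[R]_n) (a : 'I_N) (y : 'rV[R]_n) :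
  'rV[R]_N := (sigma * (rho - sqdist x y)) *: delta_mx 0 a.

Lemma C1_at_ball_height (sigma rho : R) (x y : 'rV[R]_n) :
  C1_at (fun z => sigma * (rho - sqdist x z)) y.
Proof.
apply: C1_atM; first exact: C1_at_cst.
by apply: C1_atD; [exact: C1_at_cst|apply: C1_atN; exact: C1_at_sqdist].
Qed.

Lemma C1_mx_at_ball_bump sigma rho x a y : C1_mx_at (ball_bump sigma rho x a) y.
Proof.
by apply: C1_mx_atZ; [exact: C1_at_ball_height|exact: C1_mx_at_cst].
Qed.

Lemma partials_ball_bump sigma rho x a y b i :
  partials (ball_bump sigma rho x a) y b i =
  (b == a)%:R * (- 2 * sigma * (y 0 i - x 0 i)).
Proof.
have CB := C1_mx_at_ball_bump sigma rho x a y.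
rewrite mxE /partial -derive_mx_coord; last first.
  by apply: differentiable_mx => k l; exact: C1_at_differentiable (CB k l).
have Cs := C1_at_sqdist x y.
have ds : derivable (sqdist x) y (delta_mx 0 i).
  exact: diff_derivable (C1_at_differentiable Cs).
set c := - (b == a)%:R * sigma.
rewrite (_ : (fun z => _) = c *: sqdist x + cst (- c * rho)); last first.
  apply/funext => z; rewrite !mxE eqxx /=.
  by rewrite -[RHS]/(c * sqdist x z + - c * rho) /c; ring.
have dc : derivable (cst (- c * rho) : _ -> R) y (delta_mx 0 i) by exact: derivable_cst.
rewrite (deriveD (@derivableZ _ _ _ (sqdist x) c _ _ ds) dc).
rewrite (@deriveZ _ _ _ (sqdist x) c _ _ ds).
rewrite derive_cst addr0 derive_sqdist /GRing.scale /= (bigD1 i) //= big1.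
  by rewrite mxE !eqxx addr0 mulr1 /c; ring.
by move=> j /negPf ji; rewrite mxE ji andbF mulr0.
Qed.

Lemma C1_0_ball_height (sigma rho : R) (x : 'rV[R]_n) :
  C1_0 (euclidean_ball x rho) (fun z => sigma * (rho - sqdist x z)).
Proof.
have CB y := C1_at_ball_height sigma rho x y.
split; last first.
  move=> y [/closure_euclidean_ball /= le_rho /negP]; rewrite -leNgt => ge_rho.
  by rewrite (le_anti (introT andP (conj le_rho ge_rho))) subrr mulr0.
split.
- move=> y _; split; first exact: C1_at_differentiable (CB y).
  by move=> i; exact: (CB y).2.
- by apply: continuous_subspaceT => y; exact: C1_at_continuous (CB y).
- move=> i; exists (partial i (fun z => sigma * (rho - sqdist x z))); split => //.
  by apply: continuous_subspaceT => y; exact: (CB y).2.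
Qed.

(** If [K_P(Du) D(K(Du))] has a nonzero component [a] at [x], perturb in the
   direction [e_a] by a paraboloid vanishing on the boundary of a small ball.
   At a maximum point [y] of [K(Du)] over the closed ball the first variation is
   a negative multiple of the product of row [a] of [K_P(Du)] with [y - x], and
   this product is positive because that row is a direction of increase of
   [K(Du)]. *)
Lemma rank_one_minimal_tangential (n_gt0 : (0 < n)%N) (W : set 'rV[R]_n)
    (u : 'rV[R]_n -> 'rV[R]_N) :
  open W -> C2 W u -> (forall x, W x -> 0 < \det (gram (partials u x))) ->
  rank_one_locally_minimal_dilation W u ->
  forall x a, W x ->
  \sum_i dilation_grad (partials u x) a i *
         partial i (fun y => real_dilation (partials u y)) x = 0.
Proof.
move=> oW Cu det0 minu x a Wx.
pose k y := real_dilation (partials u y).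
pose L y := dilation_grad (partials u y).
pose slope y := \sum_i L y a i * partial i k y.
rewrite -[LHS]/(slope x); apply/eqP; apply: contraT => slope_neq0; exfalso.
have Ck y : W y -> C1_at k y.
  move=> Wy; apply: C1_at_real_dilation; last exact: det0.
  exact: C1_mx_at_partials Wy.
have CL y : W y -> C1_mx_at L y.
  move=> Wy; apply: C1_mx_at_dilation_grad; last exact: det0.
  exact: C1_mx_at_partials Wy.
pose sigma := Num.sg (slope x).
have sx_gt0 : 0 < sigma * slope x by rewrite -normrEsg normr_gt0.
have near_slope : \forall y \near x, 0 < sigma * slope y.
  have cslope : {for x, continuous slope}.
    apply: continuous_bigsum => i _.
    exact: (cvgM (C1_at_continuous (CL x Wx a i)) ((Ck x Wx).2 _)).
  have cs : {for x, continuous (fun y => sigma * slope y)}.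
    exact: (cvgM (cvg_cst sigma) cslope).
  exact: cvgr_gt cs _ sx_gt0.
have nW : \forall y \near x, W y by exact: open_nbhs_nbhs.
have [rho [rho0 cD DU]] := small_euclidean_ball x _ (filterI nW near_slope).
set D := euclidean_ball x rho in cD DU.
have DW : closure D `<=` W by move=> y /DU[].
have Dx : D !=set0 by exists x; exact: euclidean_ball_center.
have C1bump : C1 W (ball_bump sigma rho x a).
  by apply: C1_of_C1_mx_at => y _; exact: C1_mx_at_ball_bump.
have decr y : closure D y -> (forall z, closure D z -> k z <= k y) ->
    frobdot (L y) (partials (ball_bump sigma rho x a) y) < 0.
  move=> Dy maxy; have [Wy slopey] := DU y Dy.
  have dk := C1_at_differentiable (Ck y Wy).
  pose q : 'rV[R]_n := \row_i (sigma * L y a i).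
  have qk : 0 < 'D_q k y.
    rewrite derive_sum_partial // (_ : \sum_i _ = sigma * slope y) //.
    rewrite mulr_sumr; apply: eq_bigr => i _.
    by rewrite mxE /GRing.scale /= mulrA.
  have out := max_on_ball_outward k x y q rho rho0 dk qk
    (closure_euclidean_ball _ _ _ Dy) maxy.
  rewrite /frobdot (bigD1 a) //= [X in _ + X]big1 ?addr0; last first.
    move=> b /negPf ba; rewrite big1 // => i _.
    by rewrite partials_ball_bump ba mul0r mulr0.
  rewrite (_ : \sum_i _ = - 2 * \sum_i q 0 i * (y 0 i - x 0 i)).
    by rewrite nmulr_rlt0 // oppr_lt0.
  rewrite mulr_sumr; apply: eq_bigr => i _.
  by rewrite partials_ball_bump eqxx mul1r [q _ _]mxE -/(L y); ring.
have [e e0] := K_infty_descent n_gt0 W D u _ Cu.1 C1bump det0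
  (open_euclidean_ball x rho) Dx cD DW decr.
apply/negP; rewrite -leNgt.
have := minu D (open_euclidean_ball x rho) (conj cD DW) _
  (C1_0_ball_height (e * sigma) rho x) _ (frobnorm_delta a).
rewrite (_ : (fun y => _) = (fun y => u y + e *: ball_bump sigma rho x a y)) //.
by apply/funext => y; rewrite /ball_bump scalerA mulrA.
Qed.

End TangentialSystem.

(** * The normal system *)

Section NormalSystem.
Context {R : realType} {n N : nat}.

(** With [E] and [F] chosen so that [E *m A x *m F] is the identity, this is the
   projection of [v] along the columns of [A y *m F], multiplied by
   [\det (E *m A y *m F)] to avoid any division: its entries are polynomials in
   those of [A y]. *)
Definition kernel_section {T : Type} (A : T -> 'M[R]_(N, n)) {k} (E : 'M[R]_(k, N))
    (F : 'M[R]_(n, k)) (v : 'rV[R]_N) (y : T) : 'rV[R]_N :=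
  \det (E *m A y *m F) *: v - v *m (A y *m F) *m \adj (E *m A y *m F) *m E.

Lemma C1_mx_at_kernel_section {V : normedModType R} (A : V -> 'M[R]_(N, n)) {k}
    (E : 'M[R]_(k, N)) (F : 'M[R]_(n, k)) v y :
  C1_mx_at A y -> C1_mx_at (kernel_section A E F v) y.
Proof.
move=> CA.
have CAF : C1_mx_at (fun y => A y *m F) y by apply: C1_mx_atM => //; exact: C1_mx_at_cst.
have CB : C1_mx_at (fun y => E *m A y *m F) y.
  by apply: C1_mx_atM; [apply: C1_mx_atM => //|]; exact: C1_mx_at_cst.
apply: C1_mx_atD.
  by apply: C1_mx_atZ; [exact: C1_at_det|exact: C1_mx_at_cst].
apply: C1_mx_atN; apply: C1_mx_atM; last exact: C1_mx_at_cst.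
apply: C1_mx_atM; last exact: C1_mx_at_adj.
by apply: C1_mx_atM; first exact: C1_mx_at_cst.
Qed.

Lemma kernel_section_mul {T : Type} (A : T -> 'M[R]_(N, n)) {k}
    (E : 'M[R]_(k, N)) (F : 'M[R]_(n, k)) v y :
  kernel_section A E F v y *m (A y *m F) = 0.
Proof.
rewrite /kernel_section mulmxBl -scalemxAl -!(mulmxA _ E) (mulmxA E).
by rewrite -(mulmxA _ (\adj _)) mul_adj_mx mul_mx_scalar subrr.
Qed.

(** When the middle factor is invertible, [A y *m F] has the rank of [A y], hence
   the same column space. *)
Lemma kernel_section_eq0 {T : Type} (A : T -> 'M[R]_(N, n)) {k}
    (E : 'M[R]_(k, N)) (F : 'M[R]_(n, k)) v y :
  \rank (A y) = k -> \det (E *m A y *m F) != 0 ->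
  kernel_section A E F v y *m A y = 0.
Proof.
move=> rA dB.
have rB : \rank (E *m A y *m F) = k.
  by apply: mxrank_unit; rewrite unitmxE unitfE.
have rAF : (\rank (A y)^T <= \rank (A y *m F)^T)%N.
  by rewrite !mxrank_tr rA -{1}rB -mulmxA mxrankM_maxr.
have sub : ((A y *m F)^T <= (A y)^T)%MS by rewrite trmx_mul submxMl.
have /submxP[X AE] : ((A y)^T <= (A y *m F)^T)%MS.
  by rewrite -(geq_leqif (mxrank_leqif_sup sub)).
rewrite -[X in _ *m X]trmxK AE trmx_mul trmxK mulmxA kernel_section_mul.
by rewrite mul0mx.
Qed.

(** Where the rank of [A] is constant, every vector of the left kernel at [x]
   extends to a section of the left kernels that is as regular as [A]. *)
Lemma constant_rank_kernel_section {V : normedModType R}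
    (A : V -> 'M[R]_(N, n)) (k : nat) (x : V) (v : 'rV[R]_N) :
  (\forall y \near x, \rank (A y) = k) -> C1_mx_at A x -> v *m A x = 0 ->
  exists nu : V -> 'rV[R]_N,
    [/\ nu x = v, \forall y \near x, nu y *m A y = 0 &
        forall y, C1_mx_at A y -> C1_mx_at nu y].
Proof.
move=> rA CA vA; have rAx := nbhs_singleton rA.
have [E EA] := row_fullP (col_base_full (A x)).
have [F AF] := row_freeP (row_base_free (A x)).
have B1 : E *m A x *m F = 1%:M.
  transitivity (E *m (col_base (A x) *m row_base (A x)) *m F).
    by rewrite mulmx_base.
  by rewrite mulmxA EA mul1mx AF.
rewrite -rAx in rA.
exists (kernel_section A E F v); split.
- by rewrite /kernel_section B1 det1 scale1r mulmxA vA !mul0mx subr0.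
- have near_det : \forall y \near x, 0 < \det (E *m A y *m F).
    have CB : C1_at (fun y => \det (E *m A y *m F)) x.
      apply: C1_at_det.
      by apply: C1_mx_atM; [apply: C1_mx_atM => //|]; exact: C1_mx_at_cst.
    have d1 : 0 < \det (E *m A x *m F) by rewrite B1 det1 ltr01.
    exact: cvgr_gt (C1_at_continuous CB) _ d1.
  near=> y; apply: kernel_section_eq0; first by near: y.
  by apply: lt0r_neq0; near: y.
- by move=> y Cy; exact: C1_mx_at_kernel_section.
Unshelve. all: by end_near. Qed.

Lemma C1_closure_of_C1 {V : normedModType R} (D W : set 'rV[R]_n)
    (f : 'rV[R]_n -> V) : closure D `<=` W -> C1 W f -> C1_closure D f.
Proof.
move=> DW Cf.
have cont (g : 'rV[R]_n -> V) : (forall x, W x -> {for x, continuous g}) ->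
    {within closure D, continuous g}.
  by move=> cg; apply: continuous_in_subspaceT => x; rewrite inE => /DW; exact: cg.
split.
- by move=> x /subset_closure/DW; exact: Cf.
- by apply: cont => x /Cf[/differentiable_continuous].
- by move=> i; exists (partial i f); split => //; apply: cont => x /Cf[].
Qed.

(** Differentiating [nu y *m L y = 0] exchanges the derivatives of [nu] and those
   of [L]. *)
Lemma frobdot_kernel_section (L : 'rV[R]_n -> 'M[R]_(N, n))
    (nu : 'rV[R]_n -> 'rV[R]_N) x :
  C1_mx_at L x -> C1_mx_at nu x -> (\forall y \near x, nu y *m L y = 0) ->
  frobdot (L x) (partials nu x) =
  - \sum_c nu x 0 c * \sum_i partial i (fun y => L y c i) x.
Proof.
move=> CL Cnu nuL.
have dnu : differentiable nu x.
  by apply: differentiable_mx => k l; exact: C1_at_differentiable (Cnu k l).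
have Leibniz i : \sum_c (L x c i * partial i nu x 0 c +
    nu x 0 c * partial i (fun y => L y c i) x) = 0.
  transitivity (partial i (fun y => \sum_c nu y 0 c * L y c i) x).
    have dprod c : differentiable (fun y => nu y 0 c * L y c i) x.
      exact: C1_at_differentiable (C1_atM _ _ _ (Cnu 0 c) (CL c i)).
    rewrite /partial derive_bigsum //; apply: eq_bigr => c _.
    rewrite (@deriveM _ _ (fun y => nu y 0 c) (fun y => L y c i)).
    - by rewrite addrC (derive_mx_coord nu x _ 0 c dnu).
    - exact: diff_derivable (C1_at_differentiable (Cnu 0 c)).
    - exact: diff_derivable (C1_at_differentiable (CL c i)).
  rewrite /partial (@near_eq_derive _ _ _ _ (cst 0)) ?derive_cst //.
  near=> y; have : (nu y *m L y) 0 i = 0 by rewrite (near nuL y) // mxE.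
  by rewrite mxE.
have : \sum_i \sum_c (L x c i * partial i nu x 0 c +
    nu x 0 c * partial i (fun y => L y c i) x) = 0.
  by rewrite big1.
under eq_bigr do rewrite big_split /=.
rewrite big_split /= => /eqP; rewrite addr_eq0 => /eqP.
rewrite /frobdot exchange_big /= => sumE.
under eq_bigr do under eq_bigr do rewrite mxE.
rewrite sumE exchange_big /=; congr (- _).
by apply: eq_bigr => c _; rewrite mulr_sumr.
Unshelve. all: by end_near. Qed.

Lemma not_interfaces_near_phase (W : set 'rV[R]_n) (u : 'rV[R]_n -> 'rV[R]_N) x :
  (W `\` interfaces W u) x ->
  exists k, \forall y \near x, (W `\` interfaces W u) y /\
    \rank (ahlfors (gram (grad u y))) = k.
Proof.
move=> [Wx]; rewrite /interfaces => nI.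
have [k kn phx] : (\bigcup_(k in [set k | (k <= n)%N]) phase W u k) x.
  by apply: contrapT => nph; apply: nI.
exists k; have : \forall y \near x, phase W u k y by exact: nbhs_interior phx.
apply: filterS => y phy; have [Wy rk] := nbhs_singleton phy.
by split => //; split => // -[_]; apply; exists k.
Qed.

(** The first variation of the dilation along a section [nu] of the left kernels
   of [K_P(Du)] is the product of [nu] with minus the divergence of [K_P(Du)]. *)
Lemma minimally_distorted_normal (n_gt0 : (0 < n)%N) (W : set 'rV[R]_n)
    (u : 'rV[R]_n -> 'rV[R]_N) :
  open W -> C2 W u -> (forall x, W x -> 0 < \det (gram (partials u x))) ->
  minimally_distorted_area W u ->
  forall x (v : 'rV[R]_N), (W `\` interfaces W u) x ->
  v *m dilation_grad (partials u x) = 0 ->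
  \sum_c v 0 c *
    \sum_i partial i (fun y => dilation_grad (partials u y) c i) x = 0.
Proof.
move=> oW Cu det0 minu x v0 Ix v0L; have Wx := Ix.1.
pose L y := dilation_grad (partials u y).
pose slope (v : 'rV[R]_N) := \sum_c v 0 c * \sum_i partial i (fun y => L y c i) x.
rewrite -[LHS]/(slope v0); apply/eqP; apply: contraT => slope_neq0; exfalso.
pose v := Num.sg (slope v0) *: v0.
have slope_gt0 : 0 < slope v.
  have -> : slope v = Num.sg (slope v0) * slope v0.
    by rewrite mulr_sumr; apply: eq_bigr => c _; rewrite mxE mulrA.
  by rewrite -normrEsg normr_gt0.
have vL : v *m L x = 0 by rewrite -scalemxAl v0L scaler0.
have CL y : W y -> C1_mx_at L y.
  move=> Wy; apply: C1_mx_at_dilation_grad; last exact: det0.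
  exact: C1_mx_at_partials Wy.
have gradu y : W y -> grad u y = partials u y.
  by move=> Wy; apply: gradE; exact: (Cu.1 y Wy).1.
have [k near_phase] := not_interfaces_near_phase _ _ _ Ix.
have rL : \forall y \near x, \rank (L y) = k.
  apply: filterS near_phase => y [[Wy _] rk].
  by rewrite rank_dilation_grad ?gradu // -?gradu //; rewrite gradu //; exact: det0.
have [nu [nux nuL Cnu]] := constant_rank_kernel_section L k x v rL (CL x Wx) vL.
have C1nu : C1 W nu by apply: C1_of_C1_mx_at => y /CL; exact: Cnu.
have near_decr : \forall y \near x, frobdot (L y) (partials nu y) < 0.
  have neg : frobdot (L x) (partials nu x) < 0.
    by rewrite frobdot_kernel_section ?nux ?oppr_lt0 //; [exact: CL|exact/Cnu/CL].
  have cf : {for x, continuous (fun y => frobdot (L y) (partials nu y))}.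
    exact: continuous_frobdot (C1_mx_at_continuous _ _ (CL x Wx))
      (partials_continuous _ _ _ C1nu Wx).
  exact: cvgr_lt cf _ neg.
have [rho [rho0 cD DU]] := small_euclidean_ball x _
  (filterI near_phase (filterI nuL near_decr)).
set D := euclidean_ball x rho in cD DU.
have DI : closure D `<=` W `\` interfaces W u by move=> y /DU[[]].
have DW : closure D `<=` W by move=> y /DI[].
have Dx : D !=set0 by exists x; exact: euclidean_ball_center.
have [e e0] := K_infty_descent n_gt0 W D u nu Cu.1 C1nu det0
  (open_euclidean_ball x rho) Dx cD DW (fun y Dy _ => (DU y Dy).2.2).
apply/negP; rewrite -leNgt.
apply: (minu D (open_euclidean_ball x rho) (conj cD DI) (cst e) _ nu).
- apply: (C1_closure_of_C1 _ W) => // y _; split; first exact: differentiable_cst.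
  by move=> i; have [] := C1_at_cst e y; move=> _; exact.
- exact: (C1_closure_of_C1 _ W).
- move=> y Dy; have cDy := subset_closure Dy; have [_ [nuLy _]] := DU y cDy.
  rewrite gradu; last exact: DW.
  by rewrite dilation_PE //; apply: det0; exact: DW.
Qed.

End NormalSystem.

Theorem theorem5p2 (R : realType) (n N : nat) (n_gt0 : (0 < n)%N)
    (Omega : set 'rV[R]_n) (u : 'rV[R]_n -> 'rV[R]_N) :
  open Omega -> immersion Omega u -> C2 Omega u ->
  minimal_infty_quasiconformal_immersion Omega u ->
  (forall x, Omega x -> forall a : 'I_N,
     \sum_(i < n) \sum_(b < N) \sum_(j < n)
       dilation_P (grad u x) a i * dilation_P (grad u x) b j *
       partial i (partial j u) x 0 b = 0) /\
  (forall x, (Omega `\` interfaces Omega u) x -> forall a : 'I_N,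
     \sum_(c < N) \sum_(i < n) \sum_(b < N) \sum_(j < n)
       orth_proj (dilation_P (grad u x)) a c *
       dilation_PP c i b j (grad u x) *
       partial i (partial j u) x 0 b = 0).
Proof.
move=> oW [_ rku] Cu [minK minA].
have gradu y : Omega y -> grad u y = partials u y.
  by move=> Wy; apply: gradE; exact: (Cu.1 y Wy).1.
have det0 y : Omega y -> 0 < \det (gram (partials u y)).
  by move=> Wy; rewrite -gradu //; apply: gram_det_gt0; exact: rku.
split=> [x Wx a|x Ix a].
  rewrite gradu // dilation_PE; last exact: det0.
  rewrite -[RHS](rank_one_minimal_tangential n_gt0 Omega u oW Cu det0 minK x a Wx).
  have dK : differentiable (@real_dilation R n N) (partials u x).
    apply: C1_at_differentiable.
    exact: C1_at_real_dilation _ _ (C1_mx_at_id _) (det0 x Wx).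
  apply: eq_bigr => i _; rewrite (partial_comp_partials Omega u oW Cu) // mulr_sumr.
  apply: eq_bigr => b _; rewrite mulr_sumr; apply: eq_bigr => j _.
  rewrite derive_real_dilation ?mulrA //; exact: det0.
have Wx := Ix.1.
pose w : 'cV[R]_N := \col_c \sum_i partial i (fun y => dilation_grad (partials u y) c i) x.
set A := dilation_P (grad u x).
have AE : A = dilation_grad (partials u x).
  by rewrite /A gradu // dilation_PE //; exact: det0.
transitivity ((orth_proj A *m w) a 0).
  rewrite mxE; apply: eq_bigr => c _; rewrite [w _ _]mxE mulr_sumr.
  apply: eq_bigr => i _.
  have Cid := C1_mx_at_id (partials u x).
  have dL : differentiable (fun Q : 'M[R]_(N, n) => dilation_grad Q c i) (partials u x).
    exact: C1_at_differentiable (C1_mx_at_dilation_grad _ _ Cid (det0 x Wx) c i).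
  rewrite (partial_comp_partials Omega u oW Cu (fun Q => dilation_grad Q c i)) //.
  rewrite mulr_sumr; apply: eq_bigr => b _; rewrite mulr_sumr; apply: eq_bigr => j _.
  rewrite mulrA; congr (_ * _ * _); rewrite /dilation_PP gradu //.
  apply: near_eq_derive.
  have near_det := near_gram_det_gt0 _ _ Cid (det0 x Wx).
  by near=> Q; rewrite dilation_PE //; near: Q.
have [tK tP] := orth_projP A w.
set t := orth_proj A *m w in tK tP *.
have tA : t^T *m A = 0 by apply: trmx_inj; rewrite trmx_mul trmxK tK trmx0.
have tw : (t^T *m w) 0 0 = 0.
  rewrite AE in tA.
  rewrite -[RHS](minimally_distorted_normal n_gt0 Omega u oW Cu det0 minA x _ Ix tA).
  by rewrite mxE; apply: eq_bigr => c _; rewrite [w _ _]mxE.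
(* [t] lies in the kernel, hence is orthogonal to [w - t] as well as to [w]. *)
have tt : (t^T *m t^T^T) 0 0 == 0.
  have := tP t tK; rewrite mulmxBr => /matrixP /(_ 0 0).
  by rewrite [LHS]mxE tw [X in _ + X]mxE sub0r [RHS]mxE trmxK => /eqP; rewrite oppr_eq0.
move: tt; rewrite mulmx_tr_eq0 => /eqP t0.
by rewrite -[t]trmxK t0 trmx0 mxE.
Unshelve. all: by end_near. Qed.
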